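(* Let $\Bbbk$ be algebraically closed and let $X,Y\subset\mathbb{A}^n$ be varieties. Then for $X$ and $Y$ in general position, $\dim(X+Y)=\min\{\dim X+\dim Y,\,n\}$; that is, for general $g\in\mathrm{Aff}_n$, $\dim(gX+Y)=\min\{\dim X+\dim Y,\,n\}$.
   Context: The Minkowski sum $X+Y$ of $X,Y\subset\mathbb{A}^n$ is the Zariski closure of $\{p+q\mid p\in X,q\in Y\}$. $\mathrm{Aff}_n=\mathbb{A}^n\rtimes GL_n$ is the group of affine transformations of $\mathbb{A}^n$; ''for general $g$'' means for all $g$ in a nonempty Zariski open subset. *)

(* Defs.v *)
From HB Require Import structures.
From mathcomp Require Import all_boot all_order all_algebra.
Set Implicit Arguments. Unset Strict Implicit. Unset Printing Implicit Defensive.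
Import GRing.Theory.
Local Open Scope ring_scope.

(* Polynomial functions on a space T with coordinate functions crd:
   the smallest set of functions containing constants and coordinates,
   closed under + and *.  Over an infinite field this is exactly the
   ring of polynomials in the coordinates. *)
Inductive polyfn (k : fieldType) (T I : Type) (crd : I -> T -> k) : (T -> k) -> Prop :=
| pf_const (c : k) : polyfn crd (fun _ => c)
| pf_coord (i : I) : polyfn crd (crd i)
| pf_add f g : polyfn crd f -> polyfn crd g -> polyfn crd (fun x => f x + g x)
| pf_mul f g : polyfn crd f -> polyfn crd g -> polyfn crd (fun x => f x * g x).

Definition zeroset (k : fieldType) (T : Type) (F : (T -> k) -> Prop) (x : T) : Prop :=
  forall f, F f -> f x = 0.

Definition coordA (k : fieldType) (n : nat) (i : 'I_n) (x : 'rV[k]_n) : k := x 0 i.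

Definition zclosed (k : fieldType) (n : nat) (S : 'rV[k]_n -> Prop) : Prop :=
  exists F : ('rV[k]_n -> k) -> Prop,
    (forall f, F f -> polyfn (@coordA k n) f) /\
    (forall x, S x <-> zeroset F x).

Definition zclosure (k : fieldType) (n : nat) (S : 'rV[k]_n -> Prop) (x : 'rV[k]_n) : Prop :=
  forall C, zclosed C -> (forall y, S y -> C y) -> C x.

Definition subsetA (k : fieldType) (n : nat) (A B : 'rV[k]_n -> Prop) : Prop :=
  forall x, A x -> B x.

Definition irred_closed (k : fieldType) (n : nat) (Z : 'rV[k]_n -> Prop) : Prop :=
  zclosed Z /\ (exists x, Z x) /\
  forall Z1 Z2 : 'rV[k]_n -> Prop, zclosed Z1 -> zclosed Z2 ->
    (forall x, Z x -> Z1 x \/ Z2 x) -> subsetA Z Z1 \/ subsetA Z Z2.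

Definition variety (k : fieldType) (n : nat) (X : 'rV[k]_n -> Prop) : Prop :=
  irred_closed X.

Definition is_chain (k : fieldType) (n : nat) (X : 'rV[k]_n -> Prop)
    (c : nat -> 'rV[k]_n -> Prop) (d : nat) : Prop :=
  (forall i, (i <= d)%N -> irred_closed (c i) /\ subsetA (c i) X) /\
  (forall i, (i < d)%N -> subsetA (c i) (c i.+1) /\ exists x, c i.+1 x /\ ~ c i x).

Definition has_dim (k : fieldType) (n : nat) (X : 'rV[k]_n -> Prop) (d : nat) : Prop :=
  (exists c, is_chain X c d) /\ (forall c m, is_chain X c m -> (m <= d)%N).

(* Aff_n: pairs (A, b) with A invertible, acting by x |-> x A + b. *)
Definition aff_act (k : fieldType) (n : nat) (g : 'M[k]_n * 'rV[k]_n) (x : 'rV[k]_n)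
  : 'rV[k]_n := x *m g.1 + g.2.

Definition aff_image (k : fieldType) (n : nat) (g : 'M[k]_n * 'rV[k]_n)
    (X : 'rV[k]_n -> Prop) (z : 'rV[k]_n) : Prop :=
  exists x, X x /\ z = aff_act g x.

Definition mink_sum (k : fieldType) (n : nat) (X Y : 'rV[k]_n -> Prop) : 'rV[k]_n -> Prop :=
  zclosure (fun z => exists p q, X p /\ Y q /\ z = p + q).

Definition coordAff (k : fieldType) (n : nat) (i : ('I_n * 'I_n) + 'I_n)
    (g : 'M[k]_n * 'rV[k]_n) : k :=
  match i with inl ij => g.1 ij.1 ij.2 | inr j => g.2 0 j end.

(* P holds for general g in Aff_n: on a nonempty Zariski open subset of Aff_n,
   i.e. on Aff_n minus the zero set of some family of polynomial functions,
   this complement being nonempty. *)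
Definition general_aff (k : fieldType) (n : nat) (P : 'M[k]_n * 'rV[k]_n -> Prop) : Prop :=
  exists F : ('M[k]_n * 'rV[k]_n -> k) -> Prop,
    (forall f, F f -> polyfn (@coordAff k n) f) /\
    (exists g, g.1 \in unitmx /\ ~ zeroset F g) /\
    (forall g, g.1 \in unitmx -> ~ zeroset F g -> P g).

(* Main.v *)
(* The dimension of an irreducible closed set is the largest m for which it has a dominant
   polynomial map to affine m-space. Indeed, adjoining a function that vanishes on W but not on
   Z to m functions that are independent on W gives m+1 independent functions on Z. Conversely,
   the image of a dominant map Z -> A^(m+1) contains an open set, so some slice w_m = c of Z still
   dominates A^m, and so does an irreducible subset of it: a prime ideal containing the ideal of
   the slice and avoiding the nonzero polynomials in w_0, ..., w_(m-1).

   Upper bound: coordinates of X and of Y forming transcendence bases are dX + dY functions over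
   which all coordinates of X x Y are algebraic. Up to a common multiplier, the polynomials of
   degree at most N then span a space of dimension O(N^(dX + dY)), which leaves no room for
   dX + dY + 1 independent functions.

   Lower bound: a singular linear map moving basis coordinates of X to coordinates outside the
   basis of Y makes min(dX + dY, n) coordinates of gx + y independent on X x Y. Joining this map by
   lines to arbitrary g, these coordinates and the entries of g are independent on Aff_n x X x Y,
   so (g, x, y) |-> (g, gx + y) has an image containing an open set in these coordinates. *)
Require Import Defs.
From mathcomp Require Import all_boot all_order all_algebra.
From mathcomp Require Import boolp classical_sets ring zify.
Set Implicit Arguments. Unset Strict Implicit. Unset Printing Implicit Defensive.
Import GRing.Theory.
Local Open Scope classical_set_scope.
Local Open Scope ring_scope.

(** * Prime ideals *)

Section Ideals.
Variable R : comNzRingType.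
Implicit Types (I J S : set R) (x y : R).

Definition is_ideal I : Prop :=
  [/\ I 0, forall x y, I x -> I y -> I (x + y) & forall a x, I x -> I (a * x)].

Definition is_prime I : Prop :=
  [/\ is_ideal I, ~ I 1 & forall x y, I (x * y) -> I x \/ I y].

Lemma ideal0 I : is_ideal I -> I 0.
Proof. by case. Qed.

Lemma idealD I x y : is_ideal I -> I x -> I y -> I (x + y).
Proof. by case=> _ + _; apply. Qed.

Lemma idealMl I a x : is_ideal I -> I x -> I (a * x).
Proof. by case=> _ _; apply. Qed.

Lemma idealMr I a x : is_ideal I -> I x -> I (x * a).
Proof. by rewrite mulrC; apply: idealMl. Qed.

Lemma idealB I x y : is_ideal I -> I x -> I y -> I (x - y).
Proof. by move=> idI Ix Iy; rewrite -mulN1r; apply: idealD (idealMl _ _ _). Qed.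

Lemma ideal_sum I (L : Type) (r : seq L) (P : pred L) (F : L -> R) :
  is_ideal I -> (forall i, P i -> I (F i)) -> I (\sum_(i <- r | P i) F i).
Proof.
by move=> idI IF; apply: big_ind => // [|x y]; [apply: ideal0|apply: idealD].
Qed.

Lemma ideal_congr I x y : is_ideal I -> I (x - y) -> I x <-> I y.
Proof.
move=> idI Ixy; split=> [Ix|Iy]; first by rewrite -[y](subKr x); apply: idealB.
by rewrite -[x](subrK y); apply: idealD.
Qed.

Lemma prime_ideal I : is_prime I -> is_ideal I.
Proof. by case. Qed.

Lemma prime_notM I x y : is_prime I -> ~ I x -> ~ I y -> ~ I (x * y).
Proof. by case=> _ _ pI nIx nIy /pI []. Qed.

Lemma prime_notX I x n : is_prime I -> ~ I x -> ~ I (x ^+ n).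
Proof.
move=> pI nIx; elim: n => [|n IHn]; first by rewrite expr0; case: pI.
by rewrite exprS; apply: prime_notM.
Qed.

Definition ideal_adjoin I x : set R := [set y | exists a z, I z /\ y = a * x + z].

Lemma is_ideal_adjoin I x : is_ideal I -> is_ideal (ideal_adjoin I x).
Proof.
move=> idI; split.
- by exists 0, 0; rewrite mul0r addr0; split=> //; apply: ideal0.
- move=> _ _ [a [z [Iz ->]]] [b [u [Iu ->]]]; exists (a + b), (z + u).
  by rewrite mulrDl addrACA; split=> //; apply: idealD.
- move=> c _ [a [z [Iz ->]]]; exists (c * a), (c * z).
  by rewrite mulrDr mulrA; split=> //; apply: idealMl.
Qed.

Lemma sub_ideal_adjoin I x : I `<=` ideal_adjoin I x.
Proof. by move=> y Iy; exists 0, y; rewrite mul0r add0r. Qed.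

Lemma mem_ideal_adjoin I x : is_ideal I -> ideal_adjoin I x x.
Proof. by move=> idI; exists 1, 0; rewrite mul1r addr0; split=> //; apply: ideal0. Qed.

Lemma is_ideal_bigcup_chain (F : set (set R)) : F !=set0 -> F `<=` is_ideal ->
  total_on F subset -> is_ideal (\bigcup_(J in F) J).
Proof.
move=> [J0 FJ0] idF totF; split.
- by exists J0 => //; apply: ideal0 (idF _ FJ0).
- move=> x y [J FJ Jx] [K FK Ky].
  have [JK|KJ] := totF _ _ FJ FK.
    by exists K => //; apply: idealD (idF _ FK) (JK _ Jx) Ky.
  by exists J => //; apply: idealD (idF _ FJ) Jx (KJ _ Ky).
- by move=> a x [J FJ Jx]; exists J => //; apply: idealMl (idF _ FJ) Jx.
Qed.

Definition ideal_avoiding S J : Prop := is_ideal J /\ J `<=` ~` S.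

Lemma exists_maximal_ideal_avoiding I S : ideal_avoiding S I ->
  exists P, [/\ ideal_avoiding S P, I `<=` P &
    forall J, ideal_avoiding S J -> P `<=` J -> J `<=` P].
Proof.
move=> avI.
(* The empty set is admitted because it is the union of the empty chain. *)
pose good : set (set R) := [set J | J = set0 \/ ideal_avoiding S J /\ I `<=` J].
have [F Fgood Ftot|P [gP maxP]] := @Zorn_bigcup R good.
  pose F' := F `&` [set J | ideal_avoiding S J /\ I `<=` J].
  have -> : \bigcup_(J in F) J = \bigcup_(J in F') J.
    apply/seteqP; split=> x [J FJ Jx]; exists J => //; last by case: FJ.
    by split=> //; case: (Fgood _ FJ) Jx => // ->.
  have [[J0 [FJ0 avJ0]]|/set0P/negP/negPn/eqP ->] := pselect (F' !=set0); last first.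
    by left; rewrite bigcup_set0.
  right; split; last by move=> x Ix; exists J0 => //; apply: avJ0.2.
  split; last by move=> x [J [_ [[_ +] _]]]; apply.
  apply: is_ideal_bigcup_chain; first by exists J0.
    by move=> J [_ [[]]].
  by move=> J K [FJ _] [FK _]; apply: Ftot.
have maxP' J : ideal_avoiding S J -> I `<=` J -> P `<=` J -> J `<=` P.
  move=> avJ IJ PJ; apply: contrapT => nJP; apply: (maxP J); last by right.
  by split.
have [avP IP] : ideal_avoiding S P /\ I `<=` P.
  case: gP => // P0; have : I `<=` P by apply: maxP' => //; rewrite P0.
  by rewrite P0 => /(_ 0); case; apply: ideal0 avI.1.
by exists P; split=> // J avJ PJ; apply: maxP' => //; apply: subset_trans PJ.
Qed.

Lemma maximal_ideal_avoiding_prime S P :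
  S 1 -> (forall x y, S x -> S y -> S (x * y)) -> ideal_avoiding S P ->
  (forall J, ideal_avoiding S J -> P `<=` J -> J `<=` P) -> is_prime P.
Proof.
move=> S1 SM [idP PS] maxP; split=> //; first by move=> /PS; apply.
have meets x : ~ P x -> exists2 y, S y & ideal_adjoin P x y.
  move=> nPx; apply: contrapT => no; apply: nPx.
  apply: (maxP (ideal_adjoin P x)); [|exact: sub_ideal_adjoin|exact: mem_ideal_adjoin].
  by split; [apply: is_ideal_adjoin|move=> y Py Sy; apply: no; exists y].
move=> x y Pxy; apply: contrapT => /not_orP [/meets [u Su]] /[swap] /meets [v Sv].
move=> [b [z [Pz vE]]] [a [t [Pt uE]]]; apply: (PS _ _ (SM _ _ Su Sv)).
rewrite vE uE; have -> : (a * x + t) * (b * y + z) =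
  (a * b) * (x * y) + (a * x + t) * z + (b * y) * t by ring.
by do !apply: idealD => //; apply: idealMl.
Qed.

Lemma exists_prime_avoiding I S :
  S 1 -> (forall x y, S x -> S y -> S (x * y)) -> ideal_avoiding S I ->
  exists P, [/\ is_prime P, I `<=` P & P `<=` ~` S].
Proof.
move=> S1 SM /exists_maximal_ideal_avoiding [P [avP IP maxP]].
exists P; split=> //; last exact: avP.2.
exact: maximal_ideal_avoiding_prime maxP.
Qed.

End Ideals.

(** * Extending specializations *)

Section PolynomialIdeals.
Variable R : comNzRingType.
Implicit Types (I : set {poly R}) (Q : {poly R}).

Lemma is_prime_polyC I : is_prime I -> is_prime [set c | I c%:P].
Proof.
move=> [[I0 ID IM] I1 pI]; split; [split|by rewrite /= polyC1|] => /=.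
- by rewrite polyC0.
- by move=> x y Ix Iy; rewrite polyCD; apply: ID.
- by move=> x y Iy; rewrite polyCM; apply: IM.
- by move=> x y; rewrite polyCM; apply: pI.
Qed.

Lemma ideal_of_coefs I Q : is_ideal I -> (forall i, I (Q`_i)%:P) -> I Q.
Proof.
move=> idI IQ; rewrite -[Q]coefK poly_def; apply: ideal_sum => // i _.
by rewrite -mul_polyC; apply: idealMr.
Qed.

Lemma truncate_mod_ideal I Q : is_ideal I -> ~ (forall i, I (Q`_i)%:P) ->
  exists Q', [/\ I (Q - Q'), (size Q' <= size Q)%N & ~ I (lead_coef Q')%:P].
Proof.
move=> idI nIQ.
have ex : exists m, `[< forall i, (m <= i)%N -> I (Q`_i)%:P >].
  exists (size Q); apply/asboolP => i szi; rewrite nth_default // polyC0.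
  exact: ideal0.
case: (ex_minnP ex) => m /asboolP Im minm.
have m_gt0 : (0 < m)%N by rewrite lt0n; apply/eqP => m0; apply: nIQ => i; apply: Im; rewrite m0.
have nIlead : ~ I (Q`_m.-1)%:P.
  move=> Il; suff : (m <= m.-1)%N by rewrite leqNgt prednK ?leqnn.
  apply: minm; apply/asboolP => i; rewrite leq_eqVlt => /predU1P [<- //|].
  by rewrite prednK //; apply: Im.
have sz : size (take_poly m Q) = m.
  apply/eqP; rewrite eqn_leq size_take_poly -(prednK m_gt0) ltnNge; apply/negP.
  move=> /leq_sizeP /(_ _ (leqnn _)); rewrite prednK // coef_take_poly prednK // leqnn => Q0.
  by apply: nIlead; rewrite Q0 polyC0; apply: ideal0.
exists (take_poly m Q); split; last by rewrite lead_coefE sz coef_take_poly prednK ?leqnn.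
- apply: ideal_of_coefs => // i; rewrite coefB coef_take_poly; case: ltnP => [_|/Im //].
    by rewrite subrr polyC0; apply: ideal0.
  by rewrite subr0.
- rewrite sz; apply: minm; apply/asboolP => i szi; rewrite nth_default // polyC0.
  exact: ideal0.
Qed.

Lemma size_gt1_mod_ideal I Q : I Q -> ~ I (lead_coef Q)%:P -> (1 < size Q)%N.
Proof.
move=> IQ nlQ; rewrite ltnNge; apply/negP => /size1_polyC Qc.
by apply: nlQ; rewrite Qc lead_coefC -Qc.
Qed.

End PolynomialIdeals.

Section Extension.
Variables (R : idomainType) (I : set {poly R}).
Hypothesis prI : is_prime I.
Implicit Types P Q b : {poly R}.

Let idI : is_ideal I := prime_ideal prI.

Definition minimal_mod P : Prop := [/\ I P, ~ I (lead_coef P)%:P &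
  forall Q, I Q -> ~ I (lead_coef Q)%:P -> (size P <= size Q)%N].

Lemma exists_minimal_mod Q : I Q -> ~ (forall i, I (Q`_i)%:P) -> exists P, minimal_mod P.
Proof.
move=> IQ /(truncate_mod_ideal idI) [Q' [IQQ' _ nlQ']].
have IQ' : I Q' by apply/(ideal_congr idI IQQ').
pose degree m := `[< exists P, [/\ I P, ~ I (lead_coef P)%:P & size P = m] >].
have ex : exists m, degree m by exists (size Q'); apply/asboolP; exists Q'.
case: (ex_minnP ex) => m /asboolP [P [IP nlP szP]] minm.
exists P; split=> // U IU nlU; rewrite szP; apply: minm; apply/asboolP.
by exists U.
Qed.

Lemma minimal_mod_small P Q : minimal_mod P ->
  I Q -> (size Q < size P)%N -> forall i, I (Q`_i)%:P.
Proof.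
move=> [_ _ minP] IQ szQ; apply: contrapT => /(truncate_mod_ideal idI).
move=> [Q' [IQQ' szQ' nlQ']]; have IQ' : I Q' by apply/(ideal_congr idI IQQ').
by have := minP _ IQ' nlQ'; rewrite leqNgt (leq_ltn_trans szQ').
Qed.

Lemma modp_congr P Q : I P -> I ((lead_coef P ^+ scalp Q P)%:P * Q - Q %% P).
Proof.
by move=> IP; rewrite mul_polyC Pdiv.Idomain.divp_eq addrK; apply: idealMl.
Qed.

(* Otherwise the quotient of P by b would lie in I and have smaller degree than P. *)
Lemma minimal_mod_remainder P b : minimal_mod P -> ~ I (lead_coef b)%:P ->
  (1 < size b < size P)%N -> ~ I (P %% b).
Proof.
move=> minP nlb /andP [szb szbP] Ir; have [IP nlP smallest] := minP.
have nl : ~ I ((lead_coef b ^+ scalp P b)%:P * (lead_coef P)%:P).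
  by apply: prime_notM => //; rewrite polyC_exp; apply: prime_notX.
have E := Pdiv.Idomain.divp_eq P b; set W := P %/ b in E.
have b0 : b != 0 by rewrite -size_poly_gt0 (leq_trans _ szb).
have szW : size W = (size P - (size b).-1)%N by rewrite Pdiv.Idomain.size_divp.
have nlW : ~ I (lead_coef W)%:P.
  have szr : (size (P %% b)%R < size (W * b)%R)%N.
    have W0 : W != 0 by rewrite -size_poly_gt0 szW; lia.
    rewrite size_mul // szW; have : (size (P %% b)%R < size b)%N by rewrite Pdiv.Idomain.ltn_modp.
    lia.
  have := congr1 lead_coef E; rewrite lead_coefZ lead_coefDl // lead_coefM => El IlW.
  by apply: nl; rewrite -polyCM El polyCM; apply: idealMr.
have IW : I W.
  have : I (W * b).
    have -> : W * b = (lead_coef b ^+ scalp P b)%:P * P - P %% b by rewrite mul_polyC E addrK.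
    by apply: idealB => //; apply: idealMl.
  case: prI => _ _ pI /pI [//|Ib]; case: nlb; apply: minimal_mod_small minP Ib szbP _.
by have := smallest _ IW nlW; rewrite szW; lia.
Qed.

Lemma bezout_mod P b : minimal_mod P -> ~ I b ->
  exists (V : {poly R}) (c : R), ~ I c%:P /\ I (c%:P - V * b).
Proof.
move=> minP; have [IP nlP _] := minP; have szP1 := size_gt1_mod_ideal IP nlP.
have [m] := ubnP (size b); elim: m b => // m IHm b szb nIb.
have [szP|szP] := leqP (size P) (size b).
  have Ir := modp_congr b IP; set l := (_ ^+ _)%:P in Ir.
  have nIlb : ~ I (l * b).
    by apply: prime_notM; rewrite // /l polyC_exp; apply: prime_notX.
  have szr : (size (b %% P)%R < m)%N.
    rewrite (leq_trans (leq_trans _ szP)) // Pdiv.Idomain.ltn_modp.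
    by rewrite -size_poly_gt0 (leq_trans _ szP1).
  have [|V [c [nIc IV]]] := IHm (b %% P) szr; first by move/(ideal_congr idI Ir).
  exists (V * l), c; split=> //.
  have -> : c%:P - V * l * b = (c%:P - V * (b %% P)) - V * (l * b - b %% P) by ring.
  by apply: idealB => //; apply: idealMl.
have [|b' [Ibb' szb' nlb']] := truncate_mod_ideal idI (Q := b).
  by move/(ideal_of_coefs idI).
suff [V [c [nIc IV]]] : exists (V : {poly R}) (c : R), ~ I c%:P /\ I (c%:P - V * b').
  exists V, c; split=> //.
  have -> : c%:P - V * b = (c%:P - V * b') - V * (b - b') by ring.
  by apply: idealB => //; apply: idealMl.
have [szb'1|szb'1] := leqP (size b') 1.
  exists 1, b'`_0; rewrite mul1r -size1_polyC // subrr; split; last exact: ideal0.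
  by move: nlb'; rewrite (size1_polyC szb'1) lead_coefC.
have nIr : ~ I (P %% b').
  by apply: minimal_mod_remainder => //; rewrite szb'1 (leq_ltn_trans szb').
have [|V [c [nIc IV]]] := IHm (P %% b') _ nIr.
  rewrite (leq_trans _ (leq_trans szb' _)) // Pdiv.Idomain.ltn_modp.
  by rewrite -size_poly_gt0 (leq_trans _ szb'1).
exists (- V * (P %/ b')), c; split=> //.
have -> : c%:P - - V * (P %/ b') * b' =
    (c%:P - V * (P %% b')) + V * (lead_coef b' ^+ scalp P b' *: P).
  by rewrite Pdiv.Idomain.divp_eq; ring.
by apply: idealD => //; apply: idealMl => //; rewrite -mul_polyC; apply: idealMl.
Qed.

Variable k : closedFieldType.

Lemma root_minimal_mod P (phi : {rmorphism R -> k}) (z : k) : minimal_mod P ->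
  (forall c, I c%:P -> phi c = 0) -> phi (lead_coef P) != 0 -> root (map_poly phi P) z ->
  forall Q, I Q -> root (map_poly phi Q) z.
Proof.
move=> minP phi0 phil /rootP rootP Q IQ; have [IP nlP _] := minP.
have Ir : I (Q %% P).
  by apply/(ideal_congr idI (modp_congr Q IP)); apply: idealMl.
have r0 : map_poly phi (Q %% P) = 0.
  apply/polyP => i; rewrite coef_map coef0; apply: phi0; apply: (minimal_mod_small minP Ir _ i).
  by rewrite Pdiv.Idomain.ltn_modp -size_poly_gt0 (leq_trans _ (size_gt1_mod_ideal IP nlP)).
have := congr1 (fun U => (map_poly phi U).[z]) (Pdiv.Idomain.divp_eq Q P).
rewrite -mul_polyC !(rmorphD, rmorphM) /= r0 addr0 !hornerM rootP mulr0 map_polyC hornerC.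
by move/eqP; rewrite mulf_eq0 /= rmorphXn expf_eq0 (negbTE phil) andbF.
Qed.

Lemma specialization_extends b : ~ I b ->
  exists a : R, ~ I a%:P /\ forall phi : {rmorphism R -> k},
    (forall c, I c%:P -> phi c = 0) -> phi a != 0 ->
    exists z : k, (forall Q, I Q -> root (map_poly phi Q) z) /\ ~~ root (map_poly phi b) z.
Proof.
move=> nIb; have [coefI|] := pselect (forall Q, I Q -> forall i, I (Q`_i)%:P).
  have [i nIbi] : exists i, ~ I (b`_i)%:P.
    by apply/existsNP => bI; apply: nIb; apply: ideal_of_coefs.
  exists b`_i; split=> // phi phi0 phib.
  have b0 : map_poly phi b != 0 by apply: contraNneq phib => b0; rewrite -coef_map b0 coef0.
  have [z nr] := closed_nonrootP _ b0; exists z; split=> // Q IQ.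
  suff -> : map_poly phi Q = 0 by apply: root0.
  by apply/polyP => j; rewrite coef_map coef0; apply/phi0/coefI.
move=> /existsNP [Q /not_implyP [IQ /(exists_minimal_mod IQ) [P minP]]].
have [V [c [nIc IV]]] := bezout_mod minP nIb; have [IP nlP _] := minP.
exists (lead_coef P * c); split; first by rewrite polyCM; apply: prime_notM.
move=> phi phi0; rewrite rmorphM mulf_eq0 negb_or => /andP [phil phic].
have [|z rz] := closed_rootP (map_poly phi P) _.
  by rewrite size_map_poly_id0 // gtn_eqF // (size_gt1_mod_ideal IP).
have rI := root_minimal_mod minP phi0 phil rz.
exists z; split=> //; apply/negP => /rootP bz.
have /rootP := rI _ IV; rewrite rmorphB rmorphM /= map_polyC hornerD hornerN hornerM bz.
by rewrite mulr0 subr0 hornerC; apply/eqP.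
Qed.

End Extension.

(** * Iterated polynomial rings *)

Fixpoint ipoly (k : fieldType) (m : nat) : idomainType :=
  if m is m'.+1 then {poly ipoly k m'} else k.

(* Assignments are infinite sequences, of which only the first m entries matter. *)
Fixpoint ipmorph (k : fieldType) (A : comNzRingType) (f : {rmorphism k -> A}) (m : nat)
    (a : nat -> A) : {rmorphism ipoly k m -> A} :=
  match m with
  | 0 => f
  | m'.+1 => horner_eval (a m') \o map_poly (ipmorph f m' a)
  end.

Notation ipeval := (ipmorph idfun).

Fixpoint ipC (k : fieldType) (n : nat) : {rmorphism k -> ipoly k n} :=
  match n with
  | 0 => idfun
  | n'.+1 => polyC \o ipC k n'
  end.

(* The junk value 0 is only taken for i >= n. *)
Fixpoint ipX (k : fieldType) (n i : nat) : ipoly k n :=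
  match n with
  | 0 => 0
  | n'.+1 => if i == n' then 'X else (ipX k n' i)%:P
  end.

Notation ipsubst n := (ipmorph (ipC _ n)).

Fixpoint ipwiden (k : fieldType) (r j : nat) : {rmorphism ipoly k j -> ipoly k (r + j)} :=
  match r with
  | 0 => idfun
  | r'.+1 => polyC \o @ipwiden k r' j
  end.

Definition ipshift (k : fieldType) (m n : nat) (p : ipoly k n) : ipoly k (n + m) :=
  ipsubst (n + m) n (fun i => ipX k (n + m) (m + i)) p.

Definition update (A : Type) (a : nat -> A) (m : nat) (x : A) (i : nat) : A :=
  if i == m then x else a i.

Definition cat_pt (A : Type) (d : nat) (a b : nat -> A) (i : nat) : A :=
  if (i < d)%N then a i else b (i - d)%N.

Lemma cat_ptl (A : Type) d (a b : nat -> A) i : (i < d)%N -> cat_pt d a b i = a i.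
Proof. by rewrite /cat_pt => ->. Qed.

Lemma cat_ptr (A : Type) d (a b : nat -> A) i : cat_pt d a b (d + i) = b i.
Proof. by rewrite /cat_pt ltnNge leq_addr /= addKn. Qed.

Lemma cat_pt_split (A : Type) d (a : nat -> A) i : cat_pt d a (fun j => a (d + j)%N) i = a i.
Proof. by rewrite /cat_pt; case: ltnP => // /subnKC ->. Qed.

Lemma eq_cat_pt (A : Type) d m (a a' b b' : nat -> A) :
  (forall i, (i < d)%N -> a i = a' i) -> (forall i, (i < m)%N -> b i = b' i) ->
  forall i, (i < d + m)%N -> cat_pt d a b i = cat_pt d a' b' i.
Proof.
move=> aa' bb' i lti; rewrite /cat_pt; case: ltnP => di; first exact: aa'.
by apply: bb'; rewrite ltn_subLR.
Qed.

Section IteratedPolynomials.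
Variable k : fieldType.

Section Morphisms.
Variables (A : comNzRingType) (f : {rmorphism k -> A}).
Implicit Type a : nat -> A.

Lemma ipmorphS m a (p : {poly ipoly k m}) :
  ipmorph f m.+1 a p = (map_poly (ipmorph f m a) p).[a m].
Proof. by []. Qed.

Lemma ipmorph_polyC m a (c : ipoly k m) : ipmorph f m.+1 a c%:P = ipmorph f m a c.
Proof. by rewrite ipmorphS map_polyC hornerC. Qed.

Lemma ipmorph_polyX m a : ipmorph f m.+1 a 'X = a m.
Proof. by rewrite ipmorphS map_polyX hornerX. Qed.

Lemma eq_ipmorph (g : {rmorphism k -> A}) m a b :
  f =1 g -> (forall i, (i < m)%N -> a i = b i) -> ipmorph f m a =1 ipmorph g m b.
Proof.
move=> fg; elim: m => [|m IHm] ab p; first exact: fg.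
rewrite /= /horner_eval ab //; congr horner.
by apply: eq_map_poly => c; apply: IHm => i im; apply: ab; apply: ltnW.
Qed.

Lemma ipmorph_update m a x (p : {poly ipoly k m}) :
  ipmorph f m.+1 (update a m x) p = (map_poly (ipmorph f m a) p).[x].
Proof.
rewrite ipmorphS {2}/update eqxx; congr horner; apply: eq_map_poly.
by apply: eq_ipmorph => // i im; rewrite /update ltn_eqF.
Qed.

Lemma ipmorph_ipC m a c : ipmorph f m a (ipC k m c) = f c.
Proof. by elim: m => [//|m IHm]; rewrite -IHm; apply: ipmorph_polyC. Qed.

Lemma ipmorph_ipX m a i : (i < m)%N -> ipmorph f m a (ipX k m i) = a i.
Proof.
elim: m => [//|m IHm]; rewrite ltnS leq_eqVlt [ipX _ _ _]/=.
case: eqVneq => [-> _|_ /= im]; first exact: ipmorph_polyX.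
by rewrite -[RHS]IHm //; apply: ipmorph_polyC.
Qed.

Lemma ipmorph_widen r j a (c : ipoly k j) : ipmorph f (r + j) a (ipwiden k r j c) = ipmorph f j a c.
Proof. by elim: r => [//|r IHr]; rewrite -[RHS]IHr; apply: ipmorph_polyC. Qed.

Lemma ipmorph_coef_wide m r a (p : {poly ipoly k m}) : (size p <= r)%N ->
  ipmorph f m.+1 a p = \sum_(j < r) ipmorph f m a p`_j * a m ^+ j.
Proof.
move=> szp; rewrite ipmorphS (@horner_coef_wide _ r) ?(leq_trans (size_poly _ _)) //.
by apply: eq_bigr => j _; rewrite coef_map.
Qed.

Lemma comp_ipmorph (B : comNzRingType) (g : {rmorphism A -> B}) m a (p : ipoly k m) :
  g (ipmorph f m a p) = ipmorph (g \o f) m (g \o a) p.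
Proof.
elim: m p => [//|m IHm] p; rewrite !ipmorphS -horner_map -map_poly_comp.
by congr horner; apply: eq_map_poly => c; apply: IHm.
Qed.

End Morphisms.

Lemma ipeval_subst m n (a : nat -> k) (q : nat -> ipoly k n) (p : ipoly k m) :
  ipeval n a (ipsubst n m q p) = ipeval m (fun i => ipeval n a (q i)) p.
Proof. by rewrite comp_ipmorph; apply: eq_ipmorph => // c /=; rewrite ipmorph_ipC. Qed.

Lemma ipeval_shift m n (a : nat -> k) (p : ipoly k n) :
  ipeval (n + m) a (ipshift m p) = ipeval n (fun i => a (m + i)%N) p.
Proof.
rewrite /ipshift ipeval_subst; apply: eq_ipmorph => // i lti.
by rewrite ipmorph_ipX // addnC ltn_add2r.
Qed.

Lemma eq_ipeval m (a b : nat -> k) : (forall i, (i < m)%N -> a i = b i) ->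
  ipeval m a =1 ipeval m b.
Proof. exact: eq_ipmorph. Qed.

Lemma ipeval_subst_cat m d n (a : nat -> k) (q r : nat -> ipoly k n) (q' r' : nat -> k)
    (p : ipoly k (d + m)) :
  (forall i, (i < d)%N -> ipeval n a (q i) = q' i) ->
  (forall i, (i < m)%N -> ipeval n a (r i) = r' i) ->
  ipeval n a (ipsubst n (d + m) (cat_pt d q r) p) = ipeval (d + m) (cat_pt d q' r') p.
Proof.
move=> qq' rr'; rewrite ipeval_subst; apply: eq_ipeval => i lti.
by rewrite -(eq_cat_pt qq' rr' lti) /cat_pt; case: ifP.
Qed.

End IteratedPolynomials.

Lemma ipeval_neq0 (k : closedFieldType) m (p : ipoly k m) : p != 0 -> exists a, ipeval m a p != 0.
Proof.
elim: m p => [|m IHm] p p0; first by exists (fun=> 0).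
have [a la] := IHm (lead_coef p) (etrans (congr1 negb (lead_coef_eq0 p)) p0).
have [|x rx] := closed_nonrootP (map_poly (ipeval m a) p) _.
  by apply: contraNneq la => E; rewrite lead_coefE -coef_map E coef0.
by exists (update a m x); rewrite ipmorph_update.
Qed.

Lemma specialization_extends_iter (k : closedFieldType) (r j : nat) (I : set (ipoly k (r + j)))
    (b : ipoly k (r + j)) : is_prime I -> ~ I b ->
  exists a : ipoly k j, ~ I (ipwiden k r j a) /\ forall p : nat -> k,
    (forall c, I (ipwiden k r j c) -> ipeval j p c = 0) -> ipeval j p a != 0 ->
    exists p', [/\ forall i, (i < j)%N -> p' i = p i,
                   forall Q, I Q -> ipeval (r + j) p' Q = 0 & ipeval (r + j) p' b != 0].
Proof.
elim: r I b => [|r IHr] I b prI nIb; first by exists b; split=> // p Ip pb; exists p.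
have [a1 [nIa1 ext1]] := specialization_extends prI k nIb.
have [a [nIa ext]] := IHr _ a1 (is_prime_polyC prI) nIa1.
exists a; split=> // p Ip pa; have [p1 [p1p p1I p1a]] := ext p Ip pa.
have [z [Iz bz]] := ext1 (ipeval (r + j) p1) p1I p1a.
exists (update p1 (r + j) z); split; last by rewrite ipmorph_update.
- by move=> i ij; rewrite /update ltn_eqF ?(leq_trans ij) ?leq_addl // p1p.
- by move=> Q IQ; rewrite ipmorph_update; apply/rootP/Iz.
Qed.

Lemma prime_has_zero (k : closedFieldType) (m : nat) (I : set (ipoly k m)) (b : ipoly k m) :
  is_prime I -> ~ I b -> exists p, (forall Q, I Q -> ipeval m p Q = 0) /\ ipeval m p b != 0.
Proof.
move: I b; rewrite -[m]addn0 => I b prI nIb.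
have [a [nIa ext]] := specialization_extends_iter prI nIb; have [idI nI1 _] := prI.
have I_const (c : k) : I (ipwiden k m 0 c) -> c = 0.
  move=> Ic; apply/eqP; apply: contraT => c0; case: nI1.
  by rewrite -(rmorph1 (ipwiden k m 0)) -(mulVf c0) rmorphM; apply: idealMl.
have [|p [_ pI pb]] := ext (fun=> 0) I_const; last by exists p.
by apply: contra_notN nIa => /eqP a0; rewrite [a]a0 rmorph0; apply: ideal0.
Qed.

(** * Polynomial functions and algebraic sets *)

Section PolynomialFunctions.
Variable k : fieldType.
Implicit Types T I : Type.

Lemma eq_polyfn T I (crd : I -> T -> k) f g : f =1 g -> polyfn crd f -> polyfn crd g.
Proof. by move=> /funext ->. Qed.

Lemma polyfn_comp T U I J (crd : I -> T -> k) (crd' : J -> U -> k) (phi : U -> T) f :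
  (forall i, polyfn crd' (fun u => crd i (phi u))) -> polyfn crd f ->
  polyfn crd' (fun u => f (phi u)).
Proof.
move=> pphi; elim=> [c|i|g h _ pg _ ph|g h _ pg _ ph]; first exact: pf_const.
- exact: pphi.
- exact: pf_add.
- exact: pf_mul.
Qed.

Lemma polyfn_eq_coord T I (crd : I -> T -> k) f t t' :
  polyfn crd f -> (forall i, crd i t = crd i t') -> f t = f t'.
Proof. by move=> pf eq_tt'; elim: pf => [//|//|g h _ -> _ ->|g h _ -> _ ->]. Qed.

Lemma polyfn_sub T I (crd : I -> T -> k) f g :
  polyfn crd f -> polyfn crd g -> polyfn crd (fun t => f t - g t).
Proof.
move=> pf pg; apply: eq_polyfn (pf_add pf (pf_mul (pf_const crd (-1)) pg)) => t.
by rewrite mulN1r.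
Qed.

Lemma polyfn_sum T I (J : Type) (crd : I -> T -> k) (r : seq J) (F : J -> T -> k) :
  (forall j, polyfn crd (F j)) -> polyfn crd (fun t => \sum_(j <- r) F j t).
Proof.
move=> pF; elim: r => [|j r IHr].
  by apply: eq_polyfn (pf_const crd 0) => t; rewrite big_nil.
by apply: eq_polyfn (pf_add (pF j) IHr) => t; rewrite big_cons.
Qed.

Lemma polyfn_prod T I (J : Type) (crd : I -> T -> k) (r : seq J) (F : J -> T -> k) :
  (forall j, polyfn crd (F j)) -> polyfn crd (fun t => \prod_(j <- r) F j t).
Proof.
move=> pF; elim: r => [|j r IHr].
  by apply: eq_polyfn (pf_const crd 1) => t; rewrite big_nil.
by apply: eq_polyfn (pf_mul (pF j) IHr) => t; rewrite big_cons.
Qed.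

Lemma polyfn_det T I n (crd : I -> T -> k) (A : T -> 'M[k]_n) :
  (forall i j, polyfn crd (fun t => A t i j)) -> polyfn crd (fun t => \det (A t)).
Proof.
move=> pA; apply: polyfn_sum => s; apply: pf_mul; first exact: pf_const.
by apply: polyfn_prod => i.
Qed.

Definition polymap T I (crd : I -> T -> k) (w : T -> nat -> k) : Prop :=
  forall i, polyfn crd (fun t => w t i).

Lemma polyfn_ipeval T I (crd : I -> T -> k) (w : T -> nat -> k) m (p : ipoly k m) :
  polymap crd w -> polyfn crd (fun t => ipeval m (w t) p).
Proof.
move=> pw; elim: m p => [|m IHm] p; first exact: pf_const.
elim/poly_ind: p => [|p c IHp].
  by apply: eq_polyfn (pf_const crd 0) => t; rewrite rmorph0.
apply: eq_polyfn (pf_add (pf_mul IHp (pw m)) (IHm c)) => t.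
by rewrite rmorphD rmorphM ipmorph_polyC ipmorph_polyX.
Qed.

Definition coord_pt T I (crd : I -> T -> k) (B : seq I) (t : T) : nat -> k :=
  nth 0 [seq crd i t | i <- B].

Lemma polymap_coord_pt T I (crd : I -> T -> k) B : polymap crd (coord_pt crd B).
Proof.
rewrite /coord_pt; elim: B => [|i B IHB] [|l] /=; try exact: pf_const.
- exact: pf_coord.
- exact: IHB.
Qed.

Lemma coord_pt_index (I : eqType) T (crd : I -> T -> k) B i t :
  i \in B -> coord_pt crd B t (index i B) = crd i t.
Proof. by move=> iB; rewrite /coord_pt (nth_map i) ?index_mem // nth_index. Qed.

(* The coordinates identify T, up to points that no polynomial function separates, with the
   affine space of all functions I -> k. *)
Definition full_coord T I (crd : I -> T -> k) : Prop :=
  forall c : I -> k, exists t, forall i, crd i t = c i.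

Section FiniteCoordinates.
Variables (T : Type) (I : finType) (crd : I -> T -> k).

Lemma index_enum_ltn (i : I) : (index i (enum I) < #|I|)%N.
Proof. by rewrite cardE index_mem mem_enum. Qed.

Lemma coord_pt_enum i t : coord_pt crd (enum I) t (index i (enum I)) = crd i t.
Proof. by rewrite coord_pt_index ?mem_enum. Qed.

Lemma polyfn_ipolyP f : polyfn crd f ->
  exists p : ipoly k #|I|, forall t, f t = ipeval #|I| (coord_pt crd (enum I) t) p.
Proof.
elim=> [c|i|g h _ [p gE] _ [q hE]|g h _ [p gE] _ [q hE]].
- by exists (ipC k #|I| c) => t; rewrite ipmorph_ipC.
- exists (ipX k #|I| (index i (enum I))) => t.
  by rewrite ipmorph_ipX ?index_enum_ltn // coord_pt_enum.
- by exists (p + q) => t; rewrite rmorphD gE hE.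
- by exists (p * q) => t; rewrite rmorphM gE hE.
Qed.

Lemma polymap_ipolyP w : polymap crd w ->
  exists q : nat -> ipoly k #|I|, forall i t, w t i = ipeval #|I| (coord_pt crd (enum I) t) (q i).
Proof. by move=> pw; have /choice [q wE] i := polyfn_ipolyP (pw i); exists q. Qed.

Lemma full_coord_pt (a : nat -> k) : full_coord crd ->
  exists t, forall l, (l < #|I|)%N -> coord_pt crd (enum I) t l = a l.
Proof.
move=> /(_ (fun i => a (index i (enum I)))) [t tE]; exists t => l.
rewrite cardE => ll; have i0 : I by move: ll; case: (enum I).
by rewrite /coord_pt (nth_map i0) // tE index_uniq ?enum_uniq.
Qed.

End FiniteCoordinates.

Section AlgebraicSets.
Variables (T I : Type) (crd : I -> T -> k).

Definition algebraic_set (S : set T) : Prop :=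
  exists F : set (T -> k), F `<=` polyfn crd /\ forall t, S t <-> zeroset F t.

Lemma algebraic_set_zero f : polyfn crd f -> algebraic_set [set t | f t = 0].
Proof.
move=> pf; exists [set f]; split=> [_ -> //|t].
by split=> [ft _ -> //|]; apply.
Qed.

Lemma algebraic_setI S1 S2 :
  algebraic_set S1 -> algebraic_set S2 -> algebraic_set (S1 `&` S2).
Proof.
move=> [F1 [pF1 SF1]] [F2 [pF2 SF2]]; exists (F1 `|` F2); split.
  by move=> f [/pF1|/pF2].
move=> t; split=> [[/SF1 F1t /SF2 F2t] f [/F1t|/F2t] //|Ft].
by split; [apply/SF1|apply/SF2] => f Ff; apply: Ft; [left|right].
Qed.

End AlgebraicSets.

Definition prod_coord T U I J (crd : I -> T -> k) (crd' : J -> U -> k) (i : I + J)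
    (t : T * U) : k :=
  match i with inl i => crd i t.1 | inr j => crd' j t.2 end.

Section Products.
Variables (T U I J : Type) (crd : I -> T -> k) (crd' : J -> U -> k).

Lemma polyfn_fst f : polyfn crd f -> polyfn (prod_coord crd crd') (fun t => f t.1).
Proof. by apply: polyfn_comp => i; apply: (pf_coord _ (inl i)). Qed.

Lemma polyfn_snd f : polyfn crd' f -> polyfn (prod_coord crd crd') (fun t => f t.2).
Proof. by apply: polyfn_comp => i; apply: (pf_coord _ (inr i)). Qed.

Lemma polyfn_pairl f u : polyfn (prod_coord crd crd') f -> polyfn crd (fun t => f (t, u)).
Proof. by apply: polyfn_comp => -[i|i] /=; [apply: pf_coord|apply: pf_const]. Qed.

Lemma polyfn_pairr f t : polyfn (prod_coord crd crd') f -> polyfn crd' (fun u => f (t, u)).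
Proof. by apply: polyfn_comp => -[i|i] /=; [apply: pf_const|apply: pf_coord]. Qed.

Lemma coord_pt_inl B t : coord_pt (prod_coord crd crd') (map inl B) t = coord_pt crd B t.1.
Proof. by rewrite /coord_pt -map_comp. Qed.

Lemma coord_pt_inr B t : coord_pt (prod_coord crd crd') (map inr B) t = coord_pt crd' B t.2.
Proof. by rewrite /coord_pt -map_comp. Qed.

End Products.

Lemma full_prod_coord T U I J (crd : I -> T -> k) (crd' : J -> U -> k) :
  full_coord crd -> full_coord crd' -> full_coord (prod_coord crd crd').
Proof.
move=> full full' c; have [t tE] := full (c \o inl); have [u uE] := full' (c \o inr).
by exists (t, u) => -[i|j]; [apply: tE|apply: uE].
Qed.

Lemma algebraic_setX T U I J (crd : I -> T -> k) (crd' : J -> U -> k) S S' :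
  algebraic_set crd S -> algebraic_set crd' S' ->
  algebraic_set (prod_coord crd crd') (S `*` S').
Proof.
move=> [F [pF SF]] [F' [pF' SF']].
exists ([set f \o fst | f in F] `|` [set f \o snd | f in F']); split.
  by move=> _ [[f Ff <-]|[f Ff <-]]; [apply/polyfn_fst/pF|apply/polyfn_snd/pF'].
move=> [t u]; split=> [[/SF Ft /SF' Fu] _ [[f Ff <-]|[f Ff <-]]|Ftu]; [exact: Ft|exact: Fu|].
by split; [apply/SF|apply/SF'] => f Ff; [apply: (Ftu (f \o fst)); left|
  apply: (Ftu (f \o snd)); right]; exists f.
Qed.

End PolynomialFunctions.

(** * Irreducible sets and dominant maps *)

Section IrreducibleSets.
Variable k : fieldType.

Definition irreducible (T I : Type) (crd : I -> T -> k) (S : set T) : Prop :=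
  S !=set0 /\ forall f g, polyfn crd f -> polyfn crd g ->
    (forall t, S t -> f t * g t = 0) -> (forall t, S t -> f t = 0) \/ (forall t, S t -> g t = 0).

Lemma irreducible_meet T I (crd : I -> T -> k) S f g :
  irreducible crd S -> polyfn crd f -> polyfn crd g ->
  (exists2 t, S t & f t != 0) -> (exists2 t, S t & g t != 0) ->
  exists2 t, S t & f t * g t != 0.
Proof.
move=> [_ irr] pf pg [t St ft] [u Su gu]; apply: contrapT => no.
have [v Sv|f0|g0] := irr f g pf pg.
- by apply/eqP/negPn/negP => fg; apply: no; exists v.
- by rewrite f0 ?eqxx in ft.
- by rewrite g0 ?eqxx in gu.
Qed.

Section Basics.
Variables (T I U J : Type) (crd : I -> T -> k) (crd' : J -> U -> k).

Lemma irreducible_image (phi : T -> U) S :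
  (forall j, polyfn crd (fun t => crd' j (phi t))) -> irreducible crd S ->
  irreducible crd' (phi @` S).
Proof.
move=> pphi [[t0 St0] irr]; split; first by exists (phi t0), t0.
move=> f g pf pg fg; have [t St|f0|g0] := irr _ _ (polyfn_comp pphi pf) (polyfn_comp pphi pg).
- by apply: fg; exists t.
- by left=> _ [t St <-]; apply: f0.
- by right=> _ [t St <-]; apply: g0.
Qed.

(* If neither f nor g vanishes on S x S', then f(-, u) and g(-, u') are nonzero on S for some
   u, u' in S', hence both are nonzero at some t in S. *)
Lemma irreducible_setX S S' : irreducible crd S -> irreducible crd' S' ->
  irreducible (prod_coord crd crd') (S `*` S').
Proof.
move=> irrS irrS'; split.
  by case: irrS irrS' => [[t St] _] [[u Su] _]; exists (t, u).
move=> f g pf pg fg; apply: contrapT => /not_orP [/existsNP [[t1 u1] /not_implyP [[St1 Su1] f1]]].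
move=> /existsNP [[t2 u2] /not_implyP [[St2 Su2] g2]].
have [| |t St] := irreducible_meet irrS (polyfn_pairl u1 pf) (polyfn_pairl u2 pg).
- by exists t1 => //; apply/eqP.
- by exists t2 => //; apply/eqP.
rewrite mulf_eq0 negb_or => /andP [ft gt].
have [| |u Su /eqP []] := irreducible_meet irrS' (polyfn_pairr t pf) (polyfn_pairr t pg).
- by exists u1.
- by exists u2.
- exact: fg.
Qed.

End Basics.

Lemma irred_closedE n (Z : 'rV[k]_n -> Prop) :
  irred_closed Z <-> algebraic_set (@coordA k n) Z /\ irreducible (@coordA k n) Z.
Proof.
split=> [[cZ [neZ irr]]|[cZ [neZ irr]]]; split=> //; split=> //.
  move=> f g pf pg fg; apply: (irr [set x | f x = 0] [set x | g x = 0]).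
  - exact: (algebraic_set_zero pf).
  - exact: (algebraic_set_zero pg).
  - by move=> x /fg /eqP; rewrite mulf_eq0 => /orP [/eqP|/eqP]; [left|right].
move=> Z1 Z2 [F1 [pF1 ZF1]] [F2 [pF2 ZF2]] Z12; apply: contrapT => /not_orP [].
have separated Z' F : (forall x, Z' x <-> @zeroset k _ F x) -> ~ subsetA Z Z' ->
    exists f x, [/\ F f, Z x & f x <> 0].
  move=> ZF /existsNP [x /not_implyP [Zx /ZF /existsNP [f /not_implyP [Ff fx]]]].
  by exists f, x.
move=> /(separated _ _ ZF1) [f [x [Ff Zx fx]]] /(separated _ _ ZF2) [g [y [Fg Zy gy]]].
have [z /Z12 [/ZF1/(_ _ Ff) ->|/ZF2/(_ _ Fg) ->]||] := irr _ _ (pF1 _ Ff) (pF2 _ Fg).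
- by rewrite mul0r.
- by rewrite mulr0.
- by move/(_ _ Zx).
- by move/(_ _ Zy).
Qed.

End IrreducibleSets.

Lemma irreducible_full (k : closedFieldType) (T : Type) (I : finType) (crd : I -> T -> k) :
  full_coord crd -> irreducible crd setT.
Proof.
move=> full; split; first by have [t _] := full (fun=> 0); exists t.
move=> _ _ /polyfn_ipolyP [p /funext ->] /polyfn_ipolyP [q /funext ->] pq.
suff /eqP : p * q = 0.
  by rewrite mulf_eq0 => /orP [/eqP ->|/eqP ->]; [left|right] => t _; rewrite rmorph0.
apply/eqP; apply: contraT => /ipeval_neq0 [a /eqP []].
have [t tE] := full_coord_pt a full; rewrite -[RHS](pq t) // -rmorphM.
by apply: eq_ipeval => l ll; rewrite tE.
Qed.

Section Dominance.
Variables (k : fieldType) (T : Type).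
Implicit Types (S : set T) (w : T -> nat -> k).

Definition vanish_on S (m : nat) w : set (ipoly k m) :=
  [set p | forall t, S t -> ipeval m (w t) p = 0].

Arguments vanish_on S m w p : clear implicits.

(* The image of S under (w_0, ..., w_(m-1)) is dense in affine m-space; equivalently, these m
   functions are algebraically independent on S. *)
Definition dominant S (m : nat) w : Prop := forall p : ipoly k m, vanish_on S m w p -> p = 0.

Lemma is_ideal_vanish_on S m w : is_ideal (vanish_on S m w).
Proof.
split; first by move=> t _; rewrite rmorph0.
- by move=> p q vp vq t St; rewrite rmorphD vp // vq // addr0.
- by move=> a p vp t St; rewrite rmorphM vp // mulr0.
Qed.

Lemma is_prime_vanish_on I (crd : I -> T -> k) S w m :
  irreducible crd S -> polymap crd w -> is_prime (vanish_on S m w).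
Proof.
move=> [[t0 St0] irr] pw; split; first exact: is_ideal_vanish_on.
- by move/(_ _ St0)/eqP; rewrite rmorph1 oner_eq0.
- move=> p q vpq; apply: (irr _ _ (polyfn_ipeval p pw) (polyfn_ipeval q pw)) => t St.
  by rewrite -rmorphM vpq.
Qed.

Lemma eq_dominant S m w w' : (forall t i, S t -> (i < m)%N -> w t i = w' t i) ->
  dominant S m w -> dominant S m w'.
Proof.
move=> ww' dom p vp; apply: dom => t St; rewrite -(vp t St).
by apply: eq_ipeval => i im; apply: ww'.
Qed.

Lemma dominant_leq S m m' w : (m <= m')%N -> dominant S m' w -> dominant S m w.
Proof.
move/subnK <-; elim: (m' - m)%N => [//|d IHd] dom; apply: IHd => p vp.
apply/eqP; rewrite -polyC_eq0; apply/eqP; apply: dom => t St.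
by rewrite -[RHS](vp t St); apply: ipmorph_polyC.
Qed.

Lemma dominant_sub S S' m w : S `<=` S' -> dominant S m w -> dominant S' m w.
Proof. by move=> SS' dom p vp; apply: dom => t /SS'; apply: vp. Qed.

Lemma dominant0 S w : S !=set0 -> dominant S 0 w.
Proof. by move=> [t St] p /(_ t St). Qed.

(* In a relation p h + c = 0 the coefficient c vanishes where h does, so h divides out. *)
Lemma dominant_adjoin I (crd : I -> T -> k) S S' w h m :
  irreducible crd S -> polymap crd w -> polyfn crd h -> S' `<=` S ->
  dominant S' m w -> (forall t, S' t -> h t = 0) -> (exists2 t, S t & h t != 0) ->
  dominant S m.+1 (fun t => update (w t) m (h t)).
Proof.
move=> [_ irr] pw ph S'S dom h0 [t0 St0 ht0] p.
elim/poly_ind: p => [//|p c IHp] vpc.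
have pcE t : ipeval m.+1 (update (w t) m (h t)) (p * 'X + c%:P) =
    ipeval m.+1 (update (w t) m (h t)) p * h t + ipeval m (w t) c.
  by rewrite !ipmorph_update rmorphD rmorphM /= map_polyX map_polyC hornerMXaddC.
have c0 : c = 0.
  apply: dom => t S't; have := vpc t (S'S _ S't).
  by rewrite pcE h0 // mulr0 add0r.
suff -> : p = 0 by rewrite c0 mul0r add0r polyC0.
apply: IHp; have pu : polymap crd (fun t => update (w t) m (h t)).
  by move=> i; rewrite /update; case: eqP.
have [t St|//|h_0] := irr _ _ (polyfn_ipeval (p : ipoly k m.+1) pu) ph.
  by have := vpc t St; rewrite pcE c0 rmorph0 addr0.
by rewrite h_0 ?eqxx in ht0.
Qed.

End Dominance.

Arguments vanish_on {k T} S m w p.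

Lemma dominant_image (k : fieldType) (T U : Type) (R : set U) (phi : U -> T) m
    (w : T -> nat -> k) : dominant (phi @` R) m w <-> dominant R m (w \o phi).
Proof.
split=> dom p vp; apply: dom; first by move=> _ [u Ru <-]; apply: vp.
by move=> u Ru; apply: vp; exists u.
Qed.

Lemma coord_pt_cat (k : fieldType) T I (crd : I -> T -> k) B C t :
  coord_pt crd (B ++ C) t = cat_pt (size B) (coord_pt crd B t) (coord_pt crd C t).
Proof. by apply/funext => i; rewrite /coord_pt /cat_pt map_cat nth_cat size_map. Qed.

Lemma polymap_cat_pt (k : fieldType) T I (crd : I -> T -> k) d v w :
  polymap crd v -> polymap crd w -> polymap crd (fun t => cat_pt d (v t) (w t)).
Proof. by move=> pv pw i; rewrite /cat_pt; case: (i < d)%N. Qed.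

Section DominanceProduct.
Variables (k : closedFieldType) (T U : Type).

(* For fixed u in R the points v s + z u are dense in affine m-space. *)
Lemma dominant_cat_shift (S : set T) (R : set U) m m' (v : T -> nat -> k) (w z : U -> nat -> k) :
  dominant S m v -> dominant R m' w ->
  dominant (S `*` R) (m' + m) (fun t => cat_pt m' (w t.2) (fun i => v t.1 i + z t.2 i)).
Proof.
move=> domv domw P vP.
have fiber u a : R u -> ipeval (m' + m) (cat_pt m' (w u) a) P = 0.
  move=> Ru; pose Q := ipsubst m (m' + m)
    (cat_pt m' (fun i => ipC k m (w u i)) (fun i => ipX k m i + ipC k m (z u i))) P.
  have QE b : ipeval m b Q = ipeval (m' + m) (cat_pt m' (w u) (fun i => b i + z u i)) P.
    apply: ipeval_subst_cat => i im; first by rewrite ipmorph_ipC.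
    by rewrite rmorphD ipmorph_ipC ipmorph_ipX.
  have Q0 : Q = 0 by apply: domv => s Ss; rewrite QE -[RHS](vP (s, u)).
  have := QE (fun i => a i - z u i); rewrite Q0 rmorph0 => ->; apply: eq_ipeval.
  by apply: eq_cat_pt => // i _; rewrite subrK.
apply/eqP; apply: contraT => /ipeval_neq0 [a /eqP []].
pose Q := ipsubst m' (m' + m) (cat_pt m' (ipX k m') (fun i => ipC k m' (a (m' + i)%N))) P.
have QE b : ipeval m' b Q = ipeval (m' + m) (cat_pt m' b (fun i => a (m' + i)%N)) P.
  by apply: ipeval_subst_cat => i im; [rewrite ipmorph_ipX|rewrite ipmorph_ipC].
have Q0 : Q = 0 by apply: domw => u Ru; rewrite QE fiber.
have := QE a; rewrite Q0 rmorph0 => ->; apply: eq_ipeval => i _.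
by rewrite cat_pt_split.
Qed.

End DominanceProduct.

Section DominantImages.
Variables (k : closedFieldType) (T : Type) (I : finType) (crd : I -> T -> k).
Hypothesis full : full_coord crd.
Implicit Types S Z : set T.

Local Notation n := #|I|.
Local Notation coords := (coord_pt crd (enum I)).

(* Apply the extension theorem to the ideal of relations between w_0, ..., w_(m-1) and the
   coordinates on S: a zero of this ideal is a point of S together with its image. *)
Lemma dominant_image_open S m (w : T -> nat -> k) :
  algebraic_set crd S -> irreducible crd S -> polymap crd w -> dominant S m w ->
  exists a : ipoly k m, a != 0 /\ forall p, ipeval m p a != 0 ->
    exists2 t, S t & forall i, (i < m)%N -> w t i = p i.
Proof.
move=> [F [pF SF]] irrS pw dom; pose u t := cat_pt m (w t) (coords t).
have pu : polymap crd u by apply: polymap_cat_pt => //; apply: polymap_coord_pt.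
have prV := is_prime_vanish_on (n + m) irrS pu; set V := vanish_on S (n + m) u in prV.
have u_shift t (q : ipoly k n) : ipeval (n + m) (u t) (ipshift m q) = ipeval n (coords t) q.
  by rewrite ipeval_shift; apply: eq_ipeval => i _; rewrite /u cat_ptr.
have [_ nV1 _] := prV; have [a [nVa ext]] := specialization_extends_iter prV nV1.
exists a; split.
  by apply: contra_notN nVa => /eqP ->; rewrite rmorph0; apply: ideal0; apply: prime_ideal.
move=> p pa; have [|p' [p'p p'V _]] := ext p _ pa.
  move=> c vc; suff -> : c = 0 by rewrite rmorph0.
  apply: dom => t St; rewrite -[RHS](vc t St) ipmorph_widen.
  by apply: eq_ipeval => i im; rewrite /u cat_ptl.
have [t tE] := full_coord_pt (fun i => p' (m + i)%N) full.
have p'_shift q : ipeval (n + m) p' (ipshift m q) = ipeval n (coords t) q.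
  by rewrite ipeval_shift; apply: eq_ipeval => i lti; rewrite tE.
exists t.
  apply/SF => f Ff; have [q fE] := polyfn_ipolyP (pF _ Ff).
  rewrite fE -p'_shift; apply: p'V => t' St'; rewrite u_shift -fE.
  by move/SF: St'; apply.
move=> i im; have [q wE] := polyfn_ipolyP (pw i).
have lti : (i < n + m)%N by rewrite ltn_addl.
apply/eqP; rewrite wE -p'_shift -p'p // -(ipmorph_ipX idfun p' lti) -subr_eq0 -rmorphB.
by apply/eqP/p'V => t' St'; rewrite rmorphB u_shift -wE ipmorph_ipX // /u cat_ptl // subrr.
Qed.

Lemma dominant_slice Z m (w : T -> nat -> k) :
  algebraic_set crd Z -> irreducible crd Z -> polymap crd w -> dominant Z m.+1 w ->
  exists c, dominant (Z `&` [set t | w t m = c]) m w.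
Proof.
move=> cZ irrZ pw /(dominant_image_open cZ irrZ pw) [a [/ipeval_neq0 [p0 ap0] lift]].
exists (p0 m) => q vq; apply/eqP; apply: contraT => q0.
pose s := ipsubst m m.+1 (update (ipX k m) m (ipC k m (p0 m))) a.
have sE p : ipeval m p s = ipeval m.+1 (update p m (p0 m)) a.
  rewrite ipeval_subst; apply: eq_ipeval => i; rewrite ltnS leq_eqVlt /update.
  by case: eqVneq => [_ _|_ /= im]; [rewrite ipmorph_ipC|rewrite ipmorph_ipX].
have s0 : s != 0.
  apply: contraNneq ap0 => s0; have := sE p0; rewrite s0 rmorph0 => ->.
  by apply/eqP/eq_ipeval => i _; rewrite /update; case: eqP => [->|].
have [p] := ipeval_neq0 (mulf_neq0 q0 s0).
rewrite rmorphM mulf_eq0 negb_or sE => /andP [/eqP qp /lift [t Zt wt]]; case: qp.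
rewrite -(vq t); last by split=> //=; rewrite wt // /update eqxx.
by apply: eq_ipeval => i im; rewrite (wt i (leqW im)) /update ltn_eqF.
Qed.

Definition common_zeros (P : set (ipoly k n)) : set T :=
  [set t | forall Q, P Q -> ipeval n (coords t) Q = 0].

Lemma algebraic_common_zeros P : algebraic_set crd (common_zeros P).
Proof.
exists [set (fun t => ipeval n (coords t) Q) | Q in P]; split.
  by move=> _ [Q _ <-]; apply: polyfn_ipeval; apply: polymap_coord_pt.
by move=> t; split=> [Pt _ [Q PQ <-]|Pt Q PQ]; [apply: Pt|apply: (Pt (fun t => _)); exists Q].
Qed.

Lemma vanish_on_common_zeros P : is_prime P -> vanish_on (common_zeros P) n coords `<=` P.
Proof.
move=> prP Q vQ; apply: contrapT => /(prime_has_zero prP) [p [pP /eqP []]].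
have [t tE] := full_coord_pt p full.
have eq_p U : ipeval n p U = ipeval n (coords t) U by apply: eq_ipeval => i lti; rewrite tE.
by rewrite eq_p; apply: vQ => U /pP; rewrite eq_p.
Qed.

Lemma irreducible_common_zeros P : is_prime P -> irreducible crd (common_zeros P).
Proof.
move=> prP; have PV := vanish_on_common_zeros prP; have [idP P1 pP] := prP; split.
  by apply/set0P/negP => /eqP W0; apply/P1/PV; rewrite W0.
move=> _ _ /polyfn_ipolyP [f /funext ->] /polyfn_ipolyP [g /funext ->] fg.
have /pP [Pf|Pg] : P (f * g) by apply: PV => t Wt; rewrite rmorphM fg.
- by left=> t; apply.
- by right=> t; apply.
Qed.

(* The polynomials in w_0, ..., w_(m-1) that are not identically zero avoid the ideal of Z, hence
   also some prime containing it. *)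
Lemma dominant_irreducible_subset Z m (w : T -> nat -> k) :
  algebraic_set crd Z -> polymap crd w -> dominant Z m w ->
  exists W, [/\ algebraic_set crd W, irreducible crd W, W `<=` Z & dominant W m w].
Proof.
move=> [F [pF ZF]] pw dom.
pose pullbacks : set (ipoly k n) := [set Q | exists2 q : ipoly k m, q != 0 &
  forall t, ipeval n (coords t) Q = ipeval m (w t) q].
have [|||P [prP ZP Pw]] := @exists_prime_avoiding _ (vanish_on Z n coords) pullbacks.
- by exists 1; [apply: oner_neq0|move=> t; rewrite !rmorph1].
- move=> Q U [q q0 Qq] [u u0 Uu]; exists (q * u); first exact: mulf_neq0.
  by move=> t; rewrite !rmorphM Qq Uu.
- split; first exact: is_ideal_vanish_on.
  by move=> Q vQ [q /eqP q0 Qq]; apply/q0/dom => t Zt; rewrite -Qq vQ.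
exists (common_zeros P); split; first exact: algebraic_common_zeros.
- exact: irreducible_common_zeros.
- move=> t Wt; apply/ZF => f Ff; have [Q fE] := polyfn_ipolyP (pF _ Ff); rewrite fE.
  by apply/Wt/ZP => u /ZF /(_ _ Ff); rewrite fE.
- move=> q vq; apply/eqP; apply: contraT => q0.
  have [Q QE] := polyfn_ipolyP (polyfn_ipeval q pw).
  case: (Pw Q); last by exists q.
  by apply: vanish_on_common_zeros => // t /vq; rewrite QE.
Qed.

Lemma dominant_proper_subset Z m (w : T -> nat -> k) :
  algebraic_set crd Z -> irreducible crd Z -> polymap crd w -> dominant Z m.+1 w ->
  exists W, [/\ algebraic_set crd W, irreducible crd W, W `<=` Z, ~ Z `<=` W & dominant W m w].
Proof.
move=> cZ irrZ pw dom; have [c dom_c] := dominant_slice cZ irrZ pw dom.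
have c_slice : algebraic_set crd (Z `&` [set t | w t m = c]).
  apply: algebraic_setI => //; have := algebraic_set_zero (polyfn_sub (pw m) (pf_const crd c)).
  congr algebraic_set; apply/seteqP; split=> t /= => [/subr0_eq //|->].
  exact: subrr.
have [W [cW irrW WZ domW]] := dominant_irreducible_subset c_slice pw dom_c.
exists W; split=> // [t /WZ [] //|ZW].
suff /eqP : ('X - (ipC k m c)%:P : {poly ipoly k m}) = 0 by rewrite polyXsubC_eq0.
apply: dom => t /ZW /WZ [_ wc]; rewrite (rmorphB (ipeval m.+1 (w t))) ipmorph_polyX.
by rewrite ipmorph_polyC ipmorph_ipC wc /= subrr.
Qed.

End DominantImages.

(** * Transcendence bases *)

Section BoxDegree.
Variable k : fieldType.

Fixpoint box_degree_le (m N : nat) : ipoly k m -> Prop :=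
  match m return ipoly k m -> Prop with
  | 0 => fun=> True
  | m'.+1 => fun p : {poly ipoly k m'} => (size p <= N.+1)%N /\ forall j, box_degree_le N p`_j
  end.

Lemma box_degree_leW m N N' (p : ipoly k m) :
  (N <= N')%N -> box_degree_le N p -> box_degree_le N' p.
Proof.
elim: m p => [//|m IHm] p NN' [szp cp]; split; first exact: leq_trans szp _.
by move=> j; apply: IHm (cp j).
Qed.

Lemma box_degree0 m N : box_degree_le N (0 : ipoly k m).
Proof. by elim: m => [//|m IHm]; split=> [|j]; [rewrite size_poly0|rewrite coef0]. Qed.

Lemma box_degreeC m N c : box_degree_le N (ipC k m c).
Proof.
elim: m => [//|m IHm]; split=> [|j]; first by rewrite (leq_trans (size_polyC_leq1 _)).
by rewrite coefC; case: eqP => _ //; apply: box_degree0.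
Qed.

Lemma box_degree1 m N : box_degree_le N (1 : ipoly k m).
Proof. by rewrite -(rmorph1 (ipC k m)); apply: box_degreeC. Qed.

Lemma box_degreeN m N (p : ipoly k m) : box_degree_le N p -> box_degree_le N (- p).
Proof.
elim: m p => [//|m IHm] p [szp cp]; split=> [|j]; first by rewrite size_polyN.
by rewrite coefN; apply: IHm; apply: cp.
Qed.

Lemma box_degreeD m N (p q : ipoly k m) :
  box_degree_le N p -> box_degree_le N q -> box_degree_le N (p + q).
Proof.
elim: m p q => [//|m IHm] p q [szp cp] [szq cq]; split=> [|j].
  by rewrite (leq_trans (size_polyD _ _)) // geq_max szp.
by rewrite coefD; apply: IHm; [apply: cp|apply: cq].
Qed.

Lemma box_degree_sum m N (J : Type) (r : seq J) (P : pred J) (F : J -> ipoly k m) :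
  (forall i, P i -> box_degree_le N (F i)) -> box_degree_le N (\sum_(i <- r | P i) F i).
Proof. by move=> bF; apply: big_ind => //; [apply: box_degree0|apply: box_degreeD]. Qed.

Lemma box_degreeM m N N' (p q : ipoly k m) :
  box_degree_le N p -> box_degree_le N' q -> box_degree_le (N + N') (p * q).
Proof.
elim: m p q => [//|m IHm] p q [szp cp] [szq cq]; split=> [|j].
  apply: leq_trans (size_polyMleq p q) _.
  by move: (size p) (size q) szp szq => a b; lia.
by rewrite coefM; apply: box_degree_sum => i _; apply: IHm; [apply: cp|apply: cq].
Qed.

Lemma box_degreeX m N e (p : ipoly k m) : box_degree_le N p -> box_degree_le (e * N) (p ^+ e).
Proof.
move=> bp; elim: e => [|e IHe]; first exact: box_degree1.
by rewrite exprS mulSn; apply: box_degreeM.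
Qed.

Lemma box_degree_bound m (p : ipoly k m) : exists N, box_degree_le N p.
Proof.
elim: m p => [|m IHm] p; first by exists 0%N.
have [N pN] : exists N, forall j, box_degree_le N p`_j.
  elim/poly_ind: p => [|p c [N pN]]; first by exists 0%N => j; rewrite coef0; apply: box_degree0.
  have [M cM] := IHm c; exists (maxn N M) => -[|j]; rewrite coefD coefMX coefC /=.
    by rewrite add0r; apply: box_degree_leW cM; apply: leq_maxr.
  by rewrite addr0; apply: box_degree_leW (pN j); apply: leq_maxl.
exists (maxn (size p) N); split; first by rewrite (leq_trans (leq_maxl _ N)).
by move=> j; apply: box_degree_leW (pN j); apply: leq_maxr.
Qed.

Lemma box_degree_bound_lt m n (q : nat -> ipoly k n) :
  exists N, forall i, (i < m)%N -> box_degree_le N (q i).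
Proof.
elim: m => [|m [N pN]]; first by exists 0%N.
have [M qmM] := box_degree_bound (q m); exists (maxn N M) => i.
rewrite ltnS leq_eqVlt => /predU1P [->|/pN qN].
  by apply: box_degree_leW qmM; apply: leq_maxr.
by apply: box_degree_leW qN; apply: leq_maxl.
Qed.

Lemma box_degree_subst m n K D (q : nat -> ipoly k n) (p : ipoly k m) :
  (forall i, (i < m)%N -> box_degree_le D (q i)) -> box_degree_le K p ->
  box_degree_le (m * (K * D)) (ipsubst n m q p).
Proof.
elim: m p => [|m IHm] p qD; first by move=> _; apply: box_degreeC.
case=> szp cp; rewrite (ipmorph_coef_wide _ _ szp); apply: box_degree_sum => j _.
rewrite mulSn addnC; apply: box_degreeM.
  by apply: (IHm _ _ (cp j)) => i im; apply: qD; apply: ltnW.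
apply: box_degree_leW (box_degreeX j (qD m (ltnSn m))).
by rewrite leq_mul2r -ltnS ltn_ord orbT.
Qed.

(* The monomials of degree < K in each variable. *)
Lemma box_basis m K : exists (E : finType) (b : E -> ipoly k m), [/\ #|E| = (K ^ m)%N,
  forall e, box_degree_le K.-1 (b e) &
  forall c : E -> k, \sum_e ipC k m (c e) * b e = 0 -> forall e, c e = 0].
Proof.
elim: m => [|m [E [b [cardE bK free]]]].
  exists unit, (fun=> 1); split=> [|//|c c0 []]; first by rewrite card_unit.
  by move: c0; rewrite (big_pred1 tt) ?mulr1 // => -[].
exists (E * 'I_K)%type, (fun e : E * 'I_K => (b e.1)%:P * 'X^(e.2) : {poly ipoly k m}); split.
- by rewrite card_prod card_ord cardE expnSr.
- move=> [e j]; split=> [|i].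
    apply/leq_sizeP => i ji; rewrite coefCM coefXn gtn_eqF ?mulr0 //.
    by move: ji (ltn_ord j) => /=; lia.
  by rewrite coefCM coefXn; case: eqP => _; rewrite ?mulr1 // mulr0; apply: box_degree0.
move=> c c0 [e j]; apply: (free (fun e => c (e, j))).
have sumE : \sum_x ipC k m.+1 (c x) * ((b x.1)%:P * 'X^(x.2)) =
    \sum_(i < K) (\sum_e ipC k m (c (e, i)) * b e) *: 'X^i.
  under [RHS]eq_bigr do rewrite scaler_suml.
  rewrite exchange_big pair_bigA; apply: eq_bigr => -[e' i] _ /=.
  by rewrite mulrA -mul_polyC polyCM.
have := congr1 (fun p : {poly ipoly k m} => p`_j) (etrans (esym sumE) c0).
rewrite coef0 coef_sum (bigD1 j) //= coefZ coefXn eqxx mulr1 [X in _ + X]big1 ?addr0 // => i ij.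
by rewrite coefZ coefXn (inj_eq val_inj) eq_sym (negbTE ij) mulr0.
Qed.

End BoxDegree.

Lemma leq_expn2r m n e : (m <= n)%N -> (m ^ e <= n ^ e)%N.
Proof. by case: e => [//|e] mn; rewrite leq_exp2r. Qed.

Section Growth.
Variables (k : fieldType) (T : Type) (S : set T).
Implicit Types (w v : T -> nat -> k) (f : T -> k).

Definition in_span (E : finType) (e : E -> T -> k) f : Prop :=
  exists c : E -> k, forall t, S t -> f t = \sum_i c i * e i t.

Lemma in_span_dependent (E E' : finType) (e : E' -> T -> k) (g : E -> T -> k) :
  (#|E'| < #|E|)%N -> (forall j, in_span e (g j)) ->
  exists c : E -> k, (exists j, c j != 0) /\ forall t, S t -> \sum_j c j * g j t = 0.
Proof.
move=> ltE /choice [d gE].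
pose A := \matrix_(j < #|E|, i < #|E'|) d (enum_val j) (enum_val i).
have /rowV0Pn [l /sub_kermxP lA /rV0Pn [j lj]] : kermx A != 0.
  by rewrite kermx_eq0 /row_free neq_ltn (leq_ltn_trans (rank_leq_col A)).
exists (fun i => l 0 (enum_rank i)); split; first by exists (enum_val j); rewrite enum_valK.
move=> t St; under eq_bigr do rewrite gE // mulr_sumr.
rewrite exchange_big big1 // => i _; transitivity ((l *m A) 0 (enum_rank i) * e i t).
  rewrite mxE mulr_suml (reindex (@enum_val E predT)) /=; last first.
    by apply: onW_bij; apply: enum_val_bij.
  by apply: eq_bigr => x _; rewrite mxE enum_rankK enum_valK mulrA.
by rewrite lA mxE mul0r.
Qed.

Definition algebraic (m : nat) w f : Prop :=
  exists P : {poly ipoly k m}, (forall t, S t -> (map_poly (ipeval m (w t)) P).[f t] = 0) /\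
    ~ forall i, vanish_on S m w P`_i.

Lemma algebraic_reindex m m' w w' (h : nat -> nat) f :
  (forall i, (i < m)%N -> (h i < m')%N) -> (forall t i, (i < m)%N -> w t i = w' t (h i)) ->
  algebraic m w f -> algebraic m' w' f.
Proof.
move=> hm ww' [P [P0 nP]].
have evE t q : ipeval m' (w' t) (ipsubst m' m (fun i => ipX k m' (h i)) q) = ipeval m (w t) q.
  by rewrite ipeval_subst; apply: eq_ipeval => i im; rewrite ipmorph_ipX ?hm // ww'.
exists (map_poly (ipsubst m' m (fun i => ipX k m' (h i))) P); split.
  move=> t St; rewrite -[RHS](P0 t St) -map_poly_comp; congr horner.
  by apply: eq_map_poly => q; apply: evE.
move=> vP; apply: nP => i t St; have := vP i t St.
by rewrite coef_map evE.
Qed.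

Lemma algebraic_mem m w i : S !=set0 -> (i < m)%N -> algebraic m w (w^~ i).
Proof.
move=> [t0 St0] im; exists ('X - (ipX k m i)%:P); split=> [t St|/(_ 1%N t0 St0)/eqP].
  by rewrite rmorphB /= map_polyX map_polyC hornerXsubC /= ipmorph_ipX ?subrr.
by rewrite coefB coefX coefC subr0 rmorph1 oner_eq0.
Qed.

Lemma dominant_extend m w f : dominant S m w -> ~ algebraic m w f ->
  dominant S m.+1 (fun t => update (w t) m (f t)).
Proof.
move=> dom nalg P vP; apply/eqP; apply: contraT => /eqP P0; case: nalg; exists P; split.
  by move=> t St; rewrite -[RHS](vP t St) ipmorph_update.
by move=> cP; apply: P0; apply/polyP => i; rewrite coef0; apply: dom; apply: cP.
Qed.

(* Up to the common multiplier h, the polynomials of box degree at most N in w_0, ..., w_(m-1)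
   span a space of dimension O(N^s). *)
Definition growth w (s m : nat) : Prop :=
  exists C, forall N, exists (E : finType) (e : E -> T -> k) (h : ipoly k m),
    [/\ (#|E| <= C * N.+1 ^ s)%N, ~ vanish_on S m w h &
        forall p : ipoly k m, box_degree_le N p ->
          in_span e (fun t => ipeval m (w t) h * ipeval m (w t) p)].

Lemma growth0 w : S !=set0 -> growth w 0 0.
Proof.
move=> [t0 St0]; exists 1%N => N; exists unit, (fun _ _ => 1), 1; split.
- by rewrite card_unit.
- by move/(_ t0 St0)/eqP; rewrite rmorph1 oner_eq0.
- by move=> p _; exists (fun=> p) => t _; rewrite (big_pred1 tt) => [|[]]; rewrite ?mulr1 ?mul1r.
Qed.

Lemma in_span_poly w m r N (E : finType) (e : E -> T -> k) (h : ipoly k m)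
    (F : {poly ipoly k m}) :
  (forall p : ipoly k m, box_degree_le N p ->
     in_span e (fun t => ipeval m (w t) h * ipeval m (w t) p)) ->
  (size F <= r)%N -> (forall i, box_degree_le N F`_i) ->
  in_span (fun (i : E * 'I_r) t => e i.1 t * w t m ^+ i.2)
    (fun t => ipeval m (w t) h * ipeval m.+1 (w t) F).
Proof.
move=> span szF bF.
have /choice [c cE] (i : 'I_r) := span F`_i (bF i).
exists (fun i => c i.2 i.1) => t St; rewrite (ipmorph_coef_wide _ _ szF) mulr_sumr.
under eq_bigr do rewrite mulrA cE // mulr_suml.
by rewrite exchange_big pair_bigA; apply: eq_bigr => i _; rewrite mulrA.
Qed.

Lemma growth_succ w s m : growth w s m -> growth w s.+1 m.+1.
Proof.
move=> [C boundC]; exists C => N; have [E [e [h [cardE nvh span]]]] := boundC N.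
exists (E * 'I_N.+1)%type, (fun (i : E * 'I_N.+1) t => e i.1 t * w t m ^+ i.2), h%:P; split.
- by rewrite card_prod card_ord expnSr mulnA leq_mul2r cardE orbT.
- by move=> vh; apply: nvh => t /vh; rewrite ipmorph_polyC.
- move=> p [szp bp]; have [c cE] := in_span_poly span szp bp.
  by exists c => t St; rewrite -cE // ipmorph_polyC.
Qed.

Lemma growth_self w s : S !=set0 -> growth w s s.
Proof. by move=> S0; elim: s => [|s IHs]; [apply: growth0|apply: growth_succ]. Qed.

Section AlgebraicStep.
Variables (w : T -> nat -> k) (m r d : nat) (P : {poly ipoly k m}).
Hypotheses (vP : forall t, S t -> ipeval m.+1 (w t) P = 0) (szP : size P = r.+2).
Hypothesis bP : forall i, box_degree_le d P`_i.

Let l := lead_coef P.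

Lemma reduce_power j : exists c : {poly ipoly k m}, [/\ (size c <= r.+1)%N,
  forall i, box_degree_le (j * d) c`_i &
  forall t, S t -> ipeval m (w t) l ^+ j * w t m ^+ j = ipeval m.+1 (w t) c].
Proof.
have bl : box_degree_le d l by apply: bP.
elim: j => [|j [c [szc bc cE]]].
  exists 1; split=> [|i|t _]; first by rewrite size_poly1.
    by rewrite coef1; case: eqP => _; [apply: box_degree1|apply: box_degree0].
  by rewrite mulr1 rmorph1.
exists (l%:P * ('X * c) - (c`_r)%:P * P); split.
- apply/leq_sizeP => -[//|i]; rewrite ltnS leq_eqVlt coefB !coefCM coefXM /=.
  case/predU1P => [<-|ri]; first by rewrite /l lead_coefE szP mulrC subrr.
  by rewrite (nth_default 0 (leq_trans szc ri)) [P`_i.+1]nth_default ?szP // !mulr0 subrr.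
- move=> i; rewrite coefB !coefCM coefXM mulSn; apply: box_degreeD.
    by apply: box_degreeM => //; case: eqP => _ //; apply: box_degree0.
  by apply: box_degreeN; rewrite addnC; apply: box_degreeM.
- move=> t St; rewrite (rmorphB (ipeval m.+1 (w t))) !(rmorphM (ipeval m.+1 (w t))).
  by rewrite vP // !ipmorph_polyC ipmorph_polyX -cE // !exprS; ring.
Qed.

Lemma reduce_poly N (p : {poly ipoly k m}) : box_degree_le N (p : ipoly k m.+1) ->
  exists F : {poly ipoly k m}, [/\ (size F <= r.+1)%N,
    forall i, box_degree_le (N + N * d) F`_i &
    forall t, S t -> ipeval m (w t) l ^+ N * ipeval m.+1 (w t) p = ipeval m.+1 (w t) F].
Proof.
move=> [szp bp]; have /choice [c cP] := reduce_power.
exists (\sum_(j < N.+1) (p`_j * l ^+ (N - j))%:P * c j); split.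
- apply: leq_trans (size_sum _ _ _) _; apply/bigmax_leqP => j _.
  by have [szc _ _] := cP j; rewrite mul_polyC (leq_trans (size_scale_leq _ _)).
- move=> i; rewrite coef_sum; apply: box_degree_sum => j _; rewrite coefCM.
  have [_ bc _] := cP j; have bl := box_degreeX (N - j) (bP (size P).-1).
  apply: box_degree_leW (box_degreeM (box_degreeM (bp j) bl) (bc i)).
  by rewrite -addnA -mulnDl subnK // -ltnS.
- move=> t St; rewrite (ipmorph_coef_wide _ _ szp) rmorph_sum mulr_sumr.
  apply: eq_bigr => j _; have [_ _ cE] := cP j.
  rewrite (rmorphM (ipeval m.+1 (w t))) ipmorph_polyC -cE // rmorphM rmorphXn /=.
  by rewrite -{1}(subnK (ltn_ord j : (j <= N)%N)) exprD; ring.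
Qed.

End AlgebraicStep.

Lemma growth_algebraic w s m : (forall m, is_prime (vanish_on S m w)) ->
  algebraic m w (w^~ m) -> growth w s m -> growth w s m.+1.
Proof.
move=> prw [P0 [vP0 nP0]] [C boundC].
have [|P [vPP0 _ nlP]] := truncate_mod_ideal (prime_ideal (prw m.+1)) (Q := P0).
  by move=> v0; apply: nP0 => i t St; rewrite -(v0 i t St) ipmorph_polyC.
have vP : vanish_on S m.+1 w P by apply/(ideal_congr (prime_ideal (prw m.+1)) vPP0).
set l := lead_coef P in nlP.
have nvl : ~ vanish_on S m w l by move=> vl; apply: nlP => t St; rewrite ipmorph_polyC vl.
have [r szP] : exists r, size P = r.+2.
  by have := size_gt1_mod_ideal vP nlP; case: (size P) => [|[|r]] // _; exists r.
have [d [_ bP]] := box_degree_bound (P : ipoly k m.+1).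
exists (C * d.+1 ^ s * r.+1)%N => N.
have [E [e [h [cardE nvh span]]]] := boundC (N + N * d)%N.
exists (E * 'I_r.+1)%type, (fun (i : E * 'I_r.+1) t => e i.1 t * w t m ^+ i.2).
exists (h * l ^+ N)%:P; split.
- rewrite card_prod card_ord mulnAC leq_mul2r /= (leq_trans cardE) //.
  by rewrite -mulnA leq_mul2l -expnMn leq_expn2r ?orbT //; nia.
- have nvhl : ~ vanish_on S m w (h * l ^+ N).
    by apply: prime_notM => //; apply: prime_notX.
  by move=> vhl; apply: nvhl => t St; rewrite -(vhl t St) ipmorph_polyC.
- move=> p bp; have [F [szF bF pE]] := reduce_poly vP szP bP bp.
  have [c cE] := in_span_poly span szF bF; exists c => t St.
  by rewrite -cE // -pE // ipmorph_polyC rmorphM rmorphXn mulrA.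
Qed.

(* Monomials of degree < K in s+1 functions: K^(s+1) of them lie in a space of dimension
   O(K^s). *)
Lemma growth_not_dominant w s n v : (forall m, is_prime (vanish_on S m w)) -> growth w s n ->
  (exists q : nat -> ipoly k n, forall i t, v t i = ipeval n (w t) (q i)) ->
  ~ dominant S s.+1 v.
Proof.
move=> prw [C boundC] [q qE] dom.
have [D qD] := box_degree_bound_lt s.+1 q.
pose K := (C * (s.+1 * D).+1 ^ s).+1.
have [E [b [cardE bK free]]] := box_basis k s.+1 K.
have [E' [e [h [cardE' nvh span]]]] := boundC (s.+1 * (K.-1 * D))%N.
have ltE : (#|E'| < #|E|)%N.
  apply: leq_ltn_trans cardE' _; rewrite cardE expnS.
  have -> : (K * K ^ s = K ^ s + C * ((s.+1 * D).+1 * K) ^ s)%N.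
    by rewrite expnMn mulnA -mulSn.
  rewrite -add1n leq_add ?expn_gt0 // leq_mul2l leq_expn2r ?orbT // /K /=; nia.
have /choice [B BE] e' : exists B : ipoly k n, box_degree_le (s.+1 * (K.-1 * D)) B /\
    forall t, ipeval n (w t) B = ipeval s.+1 (v t) (b e').
  exists (ipsubst n s.+1 q (b e')); split; first exact: box_degree_subst.
  by move=> t; rewrite ipeval_subst; apply: eq_ipeval => i _; rewrite qE.
have [c [[j cj] c0]] := in_span_dependent ltE (fun e' => span (B e') (BE e').1).
case/eqP: cj; apply: free j; apply: dom => t St.
have vsum : vanish_on S n w (\sum_e' ipC k n (c e') * B e').
  case: (prw n) => _ _ /(_ h) prime_h; case: (prime_h (\sum_e' ipC k n (c e') * B e')) => //.
  move=> u Su; rewrite rmorphM rmorph_sum mulr_sumr -[RHS](c0 u Su).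
  by apply: eq_bigr => e' _; rewrite rmorphM ipmorph_ipC mulrCA.
rewrite -[RHS](vsum t St) !rmorph_sum; apply: eq_bigr => e' _.
by rewrite !rmorphM !ipmorph_ipC (BE e').2.
Qed.

End Growth.

Lemma algebraic_image (k : fieldType) (T U : Type) (R : set U) (phi : U -> T) m
    (w : T -> nat -> k) f :
  algebraic (phi @` R) m w f -> algebraic R m (w \o phi) (f \o phi).
Proof.
move=> [P [P0 nP]]; exists P; split=> [u Ru|vP]; first by apply: P0; exists u.
by apply: nP => i _ [u Ru <-]; apply: vP.
Qed.

Lemma image_fst_setX T U (S : set T) (S' : set U) : S' !=set0 -> fst @` (S `*` S') = S.
Proof.
by move=> [u Su]; apply/seteqP; split=> [_ [[t v] [St _] <-] //|t St]; exists (t, u).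
Qed.

Lemma image_snd_setX T U (S : set T) (S' : set U) : S !=set0 -> snd @` (S `*` S') = S'.
Proof.
by move=> [t St]; apply/seteqP; split=> [_ [[v u] [_ Su] <-] //|u Su]; exists (t, u).
Qed.

Section TranscendenceBases.
Variable k : fieldType.

Definition alg_generating T I (crd : I -> T -> k) (S : set T) (B : seq I) : Prop :=
  forall i, algebraic S (size B) (coord_pt crd B) (crd i).

Definition transc_basis T I (crd : I -> T -> k) (S : set T) (B : seq I) : Prop :=
  dominant S (size B) (coord_pt crd B) /\ alg_generating crd S B.

(* A duplicate-free list of algebraically independent coordinates of maximal length. *)
Lemma exists_transc_basis T (I : finType) (crd : I -> T -> k) (S : set T) : S !=set0 ->
  exists2 B, uniq B & transc_basis crd S B.
Proof.
move=> S0; pose len m := `[< exists B, [/\ uniq B, size B = m &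
  dominant S (size B) (coord_pt crd B)] >].
have len0 : exists m, len m by exists 0%N; apply/asboolP; exists [::]; split=> //; apply: dominant0.
have len_le m : len m -> (m <= #|I|)%N.
  by case/asboolP => B [uB <- _]; rewrite -(card_uniqP uB) max_card.
case: (ex_maxnP len0 len_le) => _ /asboolP [B [uB <- domB]] maxB.
exists B => //; split=> // i; have [iB|iB] := boolP (i \in B).
  have ltB : (index i B < size B)%N by rewrite index_mem.
  have := algebraic_mem (coord_pt crd B) S0 ltB; congr (algebraic _ _ _ _).
  by apply/funext => t; rewrite coord_pt_index.
apply: contrapT => nalg; suff : len (size B).+1 by move/maxB; rewrite ltnn.
apply/asboolP; exists (rcons B i); split; rewrite ?rcons_uniq ?iB ?size_rcons //.
apply: eq_dominant (dominant_extend domB nalg) => t l _ lB.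
rewrite /coord_pt map_rcons nth_rcons size_map /update ltn_neqAle -ltnS lB andbT.
by case: eqVneq => [->|_].
Qed.

Lemma alg_generating_not_dominant T (I : finType) (crd : I -> T -> k) S B v :
  irreducible crd S -> alg_generating crd S B -> polymap crd v -> ~ dominant S (size B).+1 v.
Proof.
move=> irrS genB pv; have S0 : S !=set0 by case: irrS.
pose w := coord_pt crd (B ++ enum I).
have pw : polymap crd w by apply: polymap_coord_pt.
have prw m := is_prime_vanish_on m irrS pw.
have w_low t l : (l < size B)%N -> w t l = coord_pt crd B t l.
  by move=> lB; rewrite /w coord_pt_cat cat_ptl.
have w_high t l : w t (size B + l)%N = coord_pt crd (enum I) t l.
  by rewrite /w coord_pt_cat cat_ptr.
have gr m : (m <= #|I|)%N -> growth S w (size B) (size B + m).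
  elim: m => [_|m IHm mI]; first by rewrite addn0; apply: growth_self.
  rewrite addnS; apply: growth_algebraic => //; last by apply: IHm; apply: ltnW.
  have [i wi] : exists i, (fun t => w t (size B + m)%N) = crd i.
    have i0 : I by move: mI; rewrite cardE; case: (enum I).
    exists (nth i0 (enum I) m); apply/funext => t.
    by rewrite w_high /coord_pt (nth_map i0) // -cardE.
  rewrite wi; apply: (algebraic_reindex (h := id) _ _ (genB i)) => [l lB|t l lB].
    by rewrite ltn_addr.
  by rewrite w_low.
have := gr _ (leqnn _); rewrite addnC => grI; apply: growth_not_dominant prw grI _.
have [q vE] := polymap_ipolyP pv; exists (fun i => ipshift (size B) (q i)) => i t.
by rewrite vE ipeval_shift; apply: eq_ipeval => l _; rewrite w_high.
Qed.

Lemma alg_generating_setX T U I J (crd : I -> T -> k) (crd' : J -> U -> k) S S' B B' :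
  S !=set0 -> S' !=set0 -> alg_generating crd S B -> alg_generating crd' S' B' ->
  alg_generating (prod_coord crd crd') (S `*` S') (map inl B ++ map inr B').
Proof.
move=> S0 S'0 genB genB' [i|i]; rewrite size_cat !size_map.
  have := genB i; rewrite -{1}(image_fst_setX S S'0) => /algebraic_image algB.
  apply: (algebraic_reindex (h := id) _ _ algB) => [l lB|t l lB]; first by rewrite ltn_addr.
  by rewrite coord_pt_cat size_map cat_ptl // coord_pt_inl.
have := genB' i; rewrite -{1}(image_snd_setX S' S0) => /algebraic_image algB'.
apply: (algebraic_reindex (h := addn (size B)) _ _ algB') => [l lB|t l lB].
  by rewrite ltn_add2l.
by rewrite coord_pt_cat size_map cat_ptr coord_pt_inr.
Qed.

End TranscendenceBases.

(** * Dimension *)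

Section Dimension.
Variables (k : closedFieldType) (n : nat).
Implicit Types Z W : set 'rV[k]_n.

Local Notation crd := (@coordA k n).

Lemma full_coordA : full_coord crd.
Proof. by move=> c; exists (\row_i c i) => i; rewrite /coordA mxE. Qed.

Definition dominates Z (m : nat) : Prop := exists2 w, polymap crd w & dominant Z m w.

Lemma dominates_leq Z m m' : (m <= m')%N -> dominates Z m' -> dominates Z m.
Proof. by move=> mm' [w pw dom]; exists w => //; apply: dominant_leq dom. Qed.

Lemma dominates_sub Z W m : W `<=` Z -> dominates W m -> dominates Z m.
Proof. by move=> WZ [w pw dom]; exists w => //; apply: dominant_sub dom. Qed.

Lemma dominates_succ Z W m : irred_closed W -> irred_closed Z -> W `<=` Z ->
  (exists x, Z x /\ ~ W x) -> dominates W m -> dominates Z m.+1.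
Proof.
move=> [[F [pF WF]] _] /irred_closedE [_ irrZ] WZ [x [Zx /WF]].
move=> /existsNP [h /not_implyP [Fh hx]] [w pw dom].
exists (fun x => update (w x) m (h x)).
  by move=> i; rewrite /update; case: eqP => _ //; apply: pF.
apply: (dominant_adjoin irrZ pw (pF _ Fh) WZ dom); last by exists x => //; apply/eqP.
by move=> y /WF; apply.
Qed.

Lemma chain_dominates Z c m : is_chain Z c m -> dominates Z m.
Proof.
move=> [irrc strict]; suff dom i : (i <= m)%N -> dominates (c i) i.
  by apply: dominates_sub (dom m _) => //; case: (irrc m (leqnn m)).
elim: i => [_|i IHi im].
  exists (fun _ _ => 0); first by move=> i; apply: pf_const.
  by apply: dominant0; case: (irrc 0%N) => // -[_ []].
have [[irrS _] [irr_i _]] := (irrc _ im, irrc _ (ltnW im)); have [sub ex] := strict _ im.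
by apply: dominates_succ sub ex _ => //; apply: IHi; apply: ltnW.
Qed.

Lemma dominates_chain Z m : irred_closed Z -> dominates Z m -> exists c, is_chain Z c m.
Proof.
elim: m Z => [|m IHm] Z iZ [w pw dom]; first by exists (fun=> Z); split=> i // _; split.
have [cZ irrZ] := (irred_closedE Z).1 iZ.
have [W [cW irrW WZ nZW domW]] := dominant_proper_subset full_coordA cZ irrZ pw dom.
have iW : irred_closed W by apply/irred_closedE.
have [c [irrc strict]] := IHm W iW (ex_intro2 _ _ w pw domW).
exists (fun i => if (i <= m)%N then c i else Z); split=> i im.
  case: ifP => [im'|_]; last by split.
  by have [? cW'] := irrc i im'; split=> // x /cW'; apply: WZ.
move: im; rewrite ltnS => im; rewrite im; case: ifP => [im'|im']; first exact: strict.
have <- : m = i by apply/eqP; rewrite eqn_leq im leqNgt im'.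
have [_ cW'] := irrc m (leqnn m); split; first by move=> x /cW'; apply: WZ.
by move/existsNP: nZW => [x /not_implyP [Zx nWx]]; exists x; split=> // /cW'.
Qed.

Lemma has_dim_dominates Z m :
  irred_closed Z -> dominates Z m -> ~ dominates Z m.+1 -> has_dim Z m.
Proof.
move=> iZ dom ndom; split; first exact: dominates_chain.
move=> c m' /chain_dominates dom'; rewrite leqNgt; apply/negP => mm'.
by apply: ndom; apply: dominates_leq dom'.
Qed.

Lemma has_dim_unique Z d e : has_dim Z d -> has_dim Z e -> d = e.
Proof.
by move=> [[c dc] dmax] [[c' ec] emax]; apply/eqP; rewrite eqn_leq (dmax _ _ ec) (emax _ _ dc).
Qed.

Lemma has_dim_transc_basis Z B : irred_closed Z -> transc_basis crd Z B -> has_dim Z (size B).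
Proof.
move=> iZ [domB genB]; have [_ irrZ] := (irred_closedE Z).1 iZ.
apply: has_dim_dominates => //; first by exists (coord_pt crd B) => //; apply: polymap_coord_pt.
by move=> [w pw]; apply: alg_generating_not_dominant irrZ genB pw.
Qed.

Lemma exists_transc_basis_dim Z d : irred_closed Z -> has_dim Z d ->
  exists B, [/\ uniq B, size B = d & transc_basis crd Z B].
Proof.
move=> iZ dimZ; have [B uB trB] : exists2 B, uniq B & transc_basis crd Z B.
  by apply: exists_transc_basis; case: iZ => _ [].
exists B; split=> //; apply: has_dim_unique dimZ; exact: has_dim_transc_basis.
Qed.

Lemma not_dominates_ambient Z : irred_closed Z -> ~ dominates Z n.+1.
Proof.
move=> iZ dom; have [_ irrZ] := (irred_closedE Z).1 iZ.
have [B uB [_ genB]] := exists_transc_basis crd irrZ.1.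
have szB : (size B <= n)%N by rewrite -(card_uniqP uB) -[n in (_ <= n)%N]card_ord max_card.
have [w pw] : dominates Z (size B).+1 by apply: dominates_leq dom.
exact: alg_generating_not_dominant irrZ genB pw.
Qed.

Lemma algebraic_zclosure (S : set 'rV[k]_n) : algebraic_set crd (zclosure S).
Proof.
exists [set f | polyfn crd f /\ forall x, S x -> f x = 0]; split=> [f []//|x].
split=> [Sx f [pf f0]|Sx C [F [pF CF]] SC]; first exact: (Sx _ (algebraic_set_zero pf) f0).
by apply/CF => f Ff; apply: Sx; split=> [|y /SC /CF]; [apply: pF|apply].
Qed.

Lemma sub_zclosure (S : set 'rV[k]_n) : S `<=` zclosure S.
Proof. by move=> x Sx C _; apply. Qed.

Lemma zclosure_vanish (S : set 'rV[k]_n) f :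
  polyfn crd f -> (forall x, S x -> f x = 0) -> forall x, zclosure S x -> f x = 0.
Proof. by move=> pf f0 x Sx; apply: (Sx _ (algebraic_set_zero pf) f0). Qed.

Lemma irred_closed_zclosure S : irreducible crd S -> irred_closed (zclosure S).
Proof.
move=> [[x Sx] irr]; apply/irred_closedE; split; first exact: algebraic_zclosure.
split; first by exists x; apply: sub_zclosure.
move=> f g pf pg fg; have [y Sy|f0|g0] := irr f g pf pg; first by apply: fg; apply: sub_zclosure.
- by left; apply: zclosure_vanish.
- by right; apply: zclosure_vanish.
Qed.

Lemma dominant_zclosure S m w : polymap crd w -> dominant (zclosure S) m w <-> dominant S m w.
Proof.
move=> pw; split=> [dom p vp|]; last by apply: dominant_sub; apply: sub_zclosure.
by apply: dom; apply: zclosure_vanish => //; apply: polyfn_ipeval.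
Qed.

End Dimension.

(** * General position *)

Section DominantFamilies.
Variables (k : closedFieldType) (G T : Type) (J I : finType) (cG : J -> G -> k) (crd : I -> T -> k).
Hypotheses (fullG : full_coord cG) (full : full_coord crd).
Variables (S : set T) (m : nat) (w : G * T -> nat -> k).
Hypotheses (irrS : irreducible crd S) (pw : polymap (prod_coord cG crd) w).

Local Notation N := #|J|.
Local Notation coordsG := (coord_pt cG (enum J)).

Local Notation param := (fun (_ : unit) (s : k) => s).

Lemma dominant_curve (gamma : k -> G) :
  (forall j, polyfn param (fun s => cG j (gamma s))) -> dominant S m (fun t => w (gamma 0, t)) ->
  dominant (setT `*` S) m.+1 (fun u => update (w (gamma u.1, u.2)) m u.1).
Proof.
move=> pgamma dom0; pose crd1 := prod_coord param crd.
have irr1 : irreducible crd1 (setT `*` S).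
  by apply: irreducible_setX irrS; apply: irreducible_full => c; exists (c tt) => -[].
have pw1 : polymap crd1 (fun u => w (gamma u.1, u.2)).
  move=> i; apply: polyfn_comp (pw i) => -[j|j]; first exact: (polyfn_fst crd (pgamma j)).
  exact: (pf_coord crd1 (inr j)).
apply: (dominant_adjoin (S' := pair 0 @` S) irr1 pw1 (pf_coord crd1 (inl tt))) => //.
- by move=> _ [t St <-].
- exact/dominant_image.
- by move=> _ [t St <-].
- by have [[t St] _] := irrS; exists (1, t) => //; apply: oner_neq0.
Qed.

(* Along the lines through g0 the parameter is independent of the functions w. *)
Lemma dominant_graph g0 : dominant S m (fun t => w (g0, t)) ->
  dominant (setT `*` S) (N + m) (fun u => cat_pt N (coordsG u.1) (w u)).
Proof.
move=> dom0 P vP; apply/eqP; apply: contraT => /ipeval_neq0 [p /eqP []].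
pose a0 := coordsG g0.
have /choice [line line_pt] s := full_coord_pt (fun l => a0 l + s * (p l - a0 l)) fullG.
have lineE j s : cG j (line s) =
    a0 (index j (enum J)) + s * (p (index j (enum J)) - a0 (index j (enum J))).
  by rewrite -line_pt ?index_enum_ltn // coord_pt_enum.
have pline j : polyfn param (fun s => cG j (line s)).
  pose c := p (index j (enum J)) - a0 (index j (enum J)).
  apply: eq_polyfn (pf_add (pf_const _ _) (pf_mul (pf_coord param tt) (pf_const _ c))) => s.
  by rewrite lineE.
have dom_line : dominant (setT `*` S) m.+1 (fun u => update (w (line u.1, u.2)) m u.1).
  apply: dominant_curve pline _; apply: eq_dominant dom0 => t i _ _.
  apply: (polyfn_eq_coord (polyfn_pairl t (pw i))) => j.
  by rewrite lineE mul0r addr0 /a0 coord_pt_enum.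
pose Q := ipsubst m.+1 (N + m) (cat_pt N
  (fun i => ipC k m.+1 (a0 i) + ipX k m.+1 m * ipC k m.+1 (p i - a0 i)) (ipX k m.+1)) P.
have QE a : ipeval m.+1 a Q = ipeval (N + m) (cat_pt N (coordsG (line (a m))) a) P.
  apply: ipeval_subst_cat => i im; last by rewrite ipmorph_ipX // ltnW.
  by rewrite line_pt // rmorphD rmorphM !ipmorph_ipC ipmorph_ipX.
have Q0 : Q = 0.
  apply: dom_line => -[s t] [_ St]; rewrite QE -[RHS](vP (line s, t)) //.
  apply: eq_ipeval; apply: eq_cat_pt => i im; first by rewrite /update eqxx.
  by rewrite /update ltn_eqF.
have := QE (update (fun l => p (N + l)%N) m 1); rewrite Q0 rmorph0 => ->.
apply: eq_ipeval => i lti; rewrite -(cat_pt_split N p); apply: eq_cat_pt lti => l lm.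
  by rewrite line_pt // /update eqxx mul1r addrC subrK.
by rewrite /update ltn_eqF.
Qed.

(* The map (g, t) |-> (g, w (g, t)) is dominant, so its image contains a nonempty open set; any g
   over which this set is nonempty works. *)
Lemma dominant_generic g0 : algebraic_set crd S -> dominant S m (fun t => w (g0, t)) ->
  exists F : set (G -> k), [/\ F `<=` polyfn cG, exists g, ~ zeroset F g &
    forall g, ~ zeroset F g -> dominant S m (fun t => w (g, t))].
Proof.
move=> cS /dominant_graph dom.
have cGS : algebraic_set (prod_coord cG crd) (setT `*` S).
  apply: algebraic_setX cS; exists set0; split=> // g; split=> // _ f [].
have irrGS : irreducible (prod_coord cG crd) (setT `*` S).
  exact: irreducible_setX (irreducible_full fullG) irrS.
have pu : polymap (prod_coord cG crd) (fun u => cat_pt N (coordsG u.1) (w u)).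
  by apply: polymap_cat_pt pw => i; apply: (polyfn_fst _ (polymap_coord_pt cG (enum J) i)).
have [a [a0 lift]] := dominant_image_open (full_prod_coord fullG full) cGS irrGS pu dom.
pose fiber z g := ipeval (N + m) (cat_pt N (coordsG g) z) a.
exists (range fiber); split.
- move=> _ [z _ <-]; apply: polyfn_ipeval; apply: polymap_cat_pt => [|i]; last exact: pf_const.
  exact: polymap_coord_pt.
- have [p /eqP ap] := ipeval_neq0 a0; have [g gE] := full_coord_pt p fullG.
  exists g => Fg; apply: ap; rewrite -(Fg _ (imageT fiber (fun l => p (N + l)%N))).
  apply: eq_ipeval => i lti; rewrite -(cat_pt_split N p).
  by apply: eq_cat_pt lti => // l /gE.
move=> g /existsNP [_ /not_implyP [[z0 _ <-] /eqP az0]] q vq.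
apply/eqP; apply: contraT => q0.
pose b := ipsubst m (N + m) (cat_pt N (fun i => ipC k m (coordsG g i)) (ipX k m)) a.
have bE z : ipeval m z b = fiber z g.
  by apply: ipeval_subst_cat => i im; [rewrite ipmorph_ipC|rewrite ipmorph_ipX].
have b0 : b != 0 by apply: contraNneq az0 => b0; rewrite -bE b0 rmorph0.
have [z] := ipeval_neq0 (mulf_neq0 q0 b0).
rewrite rmorphM mulf_eq0 negb_or bE => /andP [/eqP qz /lift [[g' t] [_ St] uE]].
case: qz; rewrite -(vq t St); apply: eq_ipeval => i im.
have := uE (N + i)%N; rewrite ltn_add2l !cat_ptr => <- //.
apply: (polyfn_eq_coord (polyfn_pairl t (pw i))) => j.
rewrite -!(coord_pt_enum cG); have := uE _ (ltn_addr m (index_enum_ltn j)).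
by rewrite !cat_ptl ?index_enum_ltn.
Qed.

End DominantFamilies.

Section AffineGroup.
Variables (k : closedFieldType) (n : nat).

Local Notation crd := (@coordA k n).
Local Notation aff := ('M[k]_n * 'rV[k]_n)%type.

Lemma full_coordAff : full_coord (@coordAff k n).
Proof.
move=> c; exists (\matrix_(i, j) c (inl (i, j)), \row_j c (inr j)).
by case=> [[i j]|j] /=; rewrite mxE.
Qed.

Lemma general_affI (F : set (aff -> k)) (P : aff -> Prop) :
  F `<=` polyfn (@coordAff k n) -> (exists g, ~ zeroset F g) ->
  (forall g, ~ zeroset F g -> P g) -> general_aff P.
Proof.
move=> pF [g1 nFg1] FP; exists F; split=> //; split; last by move=> g _; apply: FP.
have /existsNP [f /not_implyP [Ff /eqP fg1]] := nFg1.
have pdet : polyfn (@coordAff k n) (fun g => \det g.1).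
  by apply: polyfn_det => i j; apply: (pf_coord _ (inl (i, j))).
have [| |g _] := irreducible_meet (irreducible_full full_coordAff) (pF _ Ff) pdet.
- by exists g1.
- by exists (1%:M, 0); rewrite ?det1 ?oner_neq0.
rewrite mulf_eq0 negb_or => /andP [/eqP fg detg].
by exists g; rewrite unitmxE unitfE; split=> // /(_ _ Ff).
Qed.

Definition aff_sum (u : aff * ('rV[k]_n * 'rV[k]_n)) : 'rV[k]_n := aff_act u.1 u.2.1 + u.2.2.

Lemma polyfn_aff_sum i :
  polyfn (prod_coord (@coordAff k n) (prod_coord crd crd)) (fun u => crd i (aff_sum u)).
Proof.
set crdP := prod_coord _ _.
have pmul : polyfn crdP (fun u => \sum_j u.2.1 0 j * u.1.1 j i).
  apply: polyfn_sum => j; apply: pf_mul; first exact: (pf_coord crdP (inr (inl j))).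
  exact: (pf_coord crdP (inl (inl (j, i)))).
have paff := pf_add pmul (pf_coord crdP (inl (inr i))).
apply: eq_polyfn (pf_add paff (pf_coord crdP (inr (inr i)))) => u.
by rewrite /coordA /aff_sum /aff_act !mxE.
Qed.

Lemma mink_sum_aff_image X Y g : mink_sum (aff_image g X) Y =
  zclosure ((fun t => aff_sum (g, t)) @` (X `*` Y)).
Proof.
rewrite /mink_sum; congr zclosure; apply/seteqP; split=> [z|_ [[x y] [Xx Yy] <-]].
  by move=> [_ [y [[x [Xx ->]] [Yy ->]]]]; exists (x, y).
by exists (aff_act g x), y; split=> //; exists x.
Qed.

End AffineGroup.

Section MinkowskiSum.
Variables (k : closedFieldType) (n : nat) (X Y : set 'rV[k]_n).
Hypotheses (iX : irred_closed X) (iY : irred_closed Y).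

Local Notation crd := (@coordA k n).
Local Notation sum_set g := ((fun t => aff_sum (g, t)) @` (X `*` Y)).

Lemma irreducible_pairs : irreducible (prod_coord crd crd) (X `*` Y).
Proof. by apply: irreducible_setX; [case/irred_closedE: iX|case/irred_closedE: iY]. Qed.

Lemma polyfn_aff_sumr g i : polyfn (prod_coord crd crd) (fun t => crd i (aff_sum (g, t))).
Proof. exact: polyfn_pairr (polyfn_aff_sum k i). Qed.

Lemma irred_closed_mink_sum g : irred_closed (mink_sum (aff_image g X) Y).
Proof.
rewrite mink_sum_aff_image; apply: irred_closed_zclosure.
exact: irreducible_image (polyfn_aff_sumr g) irreducible_pairs.
Qed.

Lemma dominant_mink_sum g m w : polymap crd w ->
  dominant (mink_sum (aff_image g X) Y) m w <-> dominant (X `*` Y) m (fun t => w (aff_sum (g, t))).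
Proof. by move=> pw; rewrite mink_sum_aff_image dominant_zclosure // dominant_image. Qed.

Lemma not_dominates_mink_sum g BX BY :
  alg_generating crd X BX -> alg_generating crd Y BY ->
  ~ dominates (mink_sum (aff_image g X) Y) (size BX + size BY).+1.
Proof.
move=> genX genY [w pw dom].
have [neX neY] : X !=set0 /\ Y !=set0 by case: iX iY => _ [neX _] [_ [neY _]].
have gen := alg_generating_setX neX neY genX genY.
have pws : polymap (prod_coord crd crd) (fun t => w (aff_sum (g, t))).
  by move=> i; apply: polyfn_comp (polyfn_aff_sumr g) (pw i).
have := alg_generating_not_dominant irreducible_pairs gen pws.
by rewrite size_cat !size_map; apply; apply/dominant_mink_sum.
Qed.

End MinkowskiSum.

Section SpecialPosition.
Variables (k : closedFieldType) (n : nat).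

Local Notation crd := (@coordA k n).
Local Notation aff := ('M[k]_n * 'rV[k]_n)%type.

Definition transfer_mx (s : seq ('I_n * 'I_n)) : 'M[k]_n := \sum_(ij <- s) delta_mx ij.1 ij.2.

Lemma mul_transfer_mxE s (x : 'rV[k]_n) j :
  (x *m transfer_mx s) 0 j = \sum_(ij <- s | ij.2 == j) x 0 ij.1.
Proof.
rewrite /transfer_mx mulmx_sumr summxE [RHS]big_mkcond; apply: eq_bigr => -[i j'] _ /=.
rewrite mxE (bigD1 i) //= mxE eqxx /= big1 ?addr0 => [|l li].
  by rewrite eq_sym; case: eqP; rewrite ?mulr1 ?mulr0.
by rewrite mxE (negbTE li) mulr0.
Qed.

Lemma mul_transfer_mx_notin s (x : 'rV[k]_n) j : j \notin unzip2 s -> (x *m transfer_mx s) 0 j = 0.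
Proof.
move=> js; rewrite mul_transfer_mxE big_seq_cond big1 // => -[i j'] /andP [sij /eqP jj'].
by case/negP: js; apply/mapP; exists (i, j').
Qed.

Lemma mul_transfer_mx_in s (x : 'rV[k]_n) i j : uniq (unzip2 s) -> (i, j) \in s ->
  (x *m transfer_mx s) 0 j = x 0 i.
Proof.
elim: s => [//|[i' j'] s IHs] /= /andP [j's us].
have consE : (x *m transfer_mx ((i', j') :: s)) 0 j =
    (if j' == j then x 0 i' else 0) + (x *m transfer_mx s) 0 j.
  by rewrite !mul_transfer_mxE big_cons; case: eqP => // _; rewrite add0r.
rewrite consE in_cons => /predU1P [[-> ->]|sij].
  by rewrite eqxx mul_transfer_mx_notin ?addr0.
have js : j \in unzip2 s by apply/mapP; exists (i, j).
by rewrite IHs // ifN ?add0r //; apply: contraNneq j's => ->.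
Qed.

Lemma coord_ptD B (x y : 'rV[k]_n) l :
  coord_pt crd B (x + y) l = coord_pt crd B x l + coord_pt crd B y l.
Proof. by rewrite /coord_pt; elim: B l => [|i B IHB] [|l] //=; rewrite /coordA ?mxE ?addr0. Qed.

Lemma coord_pt_transfer_mx B s x y l : uniq (B ++ unzip2 s) ->
  coord_pt crd (B ++ unzip2 s) (aff_sum ((transfer_mx s, 0), (x, y))) l =
  cat_pt (size B) (coord_pt crd B y)
    (fun l => coord_pt crd (unzip1 s) x l + coord_pt crd (unzip2 s) y l) l.
Proof.
rewrite cat_uniq => /and3P [_ /hasPn Bs us]; rewrite /aff_sum /aff_act addr0 coord_pt_cat /cat_pt.
case: ifP => lB; rewrite coord_ptD; last first.
  congr (nth 0 _ _ + _); rewrite /unzip1 /unzip2 -!map_comp; apply/eq_in_map => -[i j] sij.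
  exact: mul_transfer_mx_in.
set z := _ *m _; have /mapP [i iB ->] : coord_pt crd B z l \in [seq crd i z | i <- B].
  by rewrite mem_nth // size_map.
rewrite [crd i z]mul_transfer_mx_notin ?add0r //.
by apply/negP => /Bs; rewrite /= iB.
Qed.

(* The coordinates in BY come from Y alone, and as many other coordinates as possible receive one
   coordinate in BX each. *)
Lemma dominant_special_position X Y BX BY :
  uniq BY -> transc_basis crd X BX -> transc_basis crd Y BY ->
  exists L (g : aff), size L = minn (size BX + size BY) n /\
    dominant (X `*` Y) (size L) (fun t => coord_pt crd L (aff_sum (g, t))).
Proof.
move=> uY [domX _] [domY _]; pose CY := enum (predC (mem BY)).
have szC : (size BY + size CY = n)%N by rewrite -(card_uniqP uY) -cardE cardC card_ord.
pose d := minn (size BX) (size CY); pose s := zip (take d BX) (take d CY).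
have szX : size (take d BX) = d by rewrite size_takel ?geq_minl.
have szCd : size (take d CY) = d by rewrite size_takel ?geq_minr.
have s1 : unzip1 s = take d BX by rewrite unzip1_zip ?szX ?szCd.
have s2 : unzip2 s = take d CY by rewrite unzip2_zip ?szX ?szCd.
have uL : uniq (BY ++ unzip2 s).
  rewrite s2 cat_uniq uY take_uniq ?enum_uniq // andbT.
  by apply/hasPn => i /mem_take; rewrite mem_enum.
have szL : size (BY ++ unzip2 s) = (size BY + d)%N by rewrite size_cat s2 szCd.
have domXd : dominant X d (coord_pt crd (unzip1 s)).
  apply: eq_dominant (dominant_leq (geq_minl _ _) domX) => x l _ ld.
  by rewrite s1 /coord_pt map_take nth_take.
exists (BY ++ unzip2 s), (transfer_mx s, 0); split.
  by rewrite szL /d addn_minr szC addnC.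
rewrite szL; have := dominant_cat_shift (z := coord_pt crd (unzip2 s)) domXd domY.
apply: eq_dominant.
by move=> [x y] l _ _; rewrite coord_pt_transfer_mx.
Qed.

End SpecialPosition.

Theorem theorem3p9 (k : closedFieldType) (n : nat) (X Y : 'rV[k]_n -> Prop) (dX dY : nat) :
  variety X -> variety Y -> has_dim X dX -> has_dim Y dY ->
  general_aff (fun g => has_dim (mink_sum (aff_image g X) Y) (minn (dX + dY) n)).
Proof.
move=> iX iY /(exists_transc_basis_dim iX) [BX [_ <- trX]].
move=> /(exists_transc_basis_dim iY) [BY [uY <- trY]].
have [L [g0 [szL dom0]]] := dominant_special_position uY trX trY.
have [[cX _] [cY _]] := ((irred_closedE X).1 iX, (irred_closedE Y).1 iY).
have pL : polymap (@coordA k n) (coord_pt (@coordA k n) L) by apply: polymap_coord_pt.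
have psum : polymap (prod_coord (@coordAff k n) (prod_coord (@coordA k n) (@coordA k n)))
    (fun u => coord_pt (@coordA k n) L (aff_sum u)).
  by move=> l; apply: polyfn_comp (@polyfn_aff_sum k n) (pL l).
have [F [pF neF domF]] := dominant_generic (@full_coordAff k n)
  (full_prod_coord (@full_coordA k n) (@full_coordA k n)) (irreducible_pairs iX iY) psum
  (algebraic_setX cX cY) dom0.
apply: general_affI pF neF _ => g /domF domg; rewrite -szL.
apply: has_dim_dominates; first exact: irred_closed_mink_sum.
  by exists (coord_pt (@coordA k n) L) => //; apply/dominant_mink_sum.
rewrite szL; case: leqP => _; first exact: not_dominates_mink_sum trX.2 trY.2.
by apply: not_dominates_ambient; apply: irred_closed_mink_sum.
Qed.
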